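(* Let $h\ge0$, $A,A_1\in\mathbb{R}^{n\times n}$ and $\gamma_m>0$, and consider the linear time-delay system $\dot e(t)=Ae_t(0)+A_1e_t(-h)+w(t)$ with input $w(t)\in\mathbb{R}^n$. The system is input-to-state stable (ISS) with gain margin $\rho(\theta)=\gamma_m\cdot\theta$ if there exist symmetric positive definite matrices $P,R,S\in\mathbb{R}^{n\times n}$ and matrices $P_2,P_3,P_4\in\mathbb{R}^{n\times n}$ such that $W<0$ (negative definite), where $W$ is the symmetric matrix $$W=\begin{bmatrix}A^\top P_2+P_2^\top A+S-R+\gamma_m^2I_n & P-P_2^\top+A^\top P_3 & P_2^\top A_1+R & P_2^\top+A^\top P_4\\ * & -P_3-P_3^\top+h^2R & P_3^\top A_1 & P_3^\top-P_4\\ * & * & -S-R & A_1^\top P_4\\ * & * & * & P_4^\top+P_4-I_n\end{bmatrix},$$ the asterisks denoting the unique blocks that make $W$ symmetric.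
   Context: Here $e_t(\theta)=e(t+\theta)$ for $\theta\in[-h,0]$, so $e_t(0)=e(t)$ and $e_t(-h)=e(t-h)$; $\|\cdot\|$ is the Euclidean norm, $\|\phi\|_h=\max_{\theta\in[-h,0]}\|\phi(\theta)\|$, and $\|w\|_\infty$ is the essential supremum norm. Comparison functions: $\alpha\in\mathcal{K}$ if $\alpha:[0,\infty)\to[0,\infty)$ is continuous, strictly increasing, $\alpha(0)=0$; $\alpha\in\mathcal{K}_\infty$ if moreover $\alpha(\theta)\to\infty$ as $\theta\to\infty$; $\beta\in\mathcal{KL}$ if $\beta(\cdot,t)\in\mathcal{K}$ for each $t\ge0$ and, for each $\theta\ge 0$, $\beta(\theta,\cdot)$ is continuous, non-increasing and tends to $0$ at infinity. ISS: a time-delay system with input $w$ is ISS if there exist $\beta\in\mathcal{KL}$ and $\mu\in\mathcal{K}$ such that for all initial functions $e_0\in\mathcal{C}([-h,0],\mathbb{R}^n)$ and all Lebesgue-measurable inputs $w$ on $[0,\infty)$, $\|e(t)\|\le\beta(\|e_0\|_h,t)+\mu(\|w\|_\infty)$ for all $t\ge0$. Gain margin: for an ISS system $\dot e(t)=f(e_t,w(t))$ with $w(t)\in\mathbb{R}^p$ and $e(t)\in\mathbb{R}^{n}$, a function $\rho\in\mathcal{K}_\infty$ is a gain margin if, for every feedback law $\kappa:\mathbb{R}^{n}\times\mathbb{R}\to\mathbb{R}^p$ satisfying $\|\kappa(\xi,t)\|\le\rho(\|\xi\|)$ for all $\xi,t$, the system $\dot e(t)=f(e_t,\kappa(e_t(0),t)+w(t))$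 is again ISS with input $w$. (Existence of solutions of the closed loop is taken for granted.) *)

(* Defs.v *)
From HB Require Import structures.
From mathcomp Require Import all_boot all_order all_algebra.
From mathcomp Require Import all_classical all_reals all_analysis.
From mathcomp Require Import ess_sup_inf.

Set Implicit Arguments.
Unset Strict Implicit.
Unset Printing Implicit Defensive.

Import Order.TTheory GRing.Theory Num.Theory.
Import numFieldNormedType.Exports.

Local Open Scope classical_set_scope.
Local Open Scope ring_scope.

Section Matrices.
Context {F : realType}.

(* The library norm `|v| on matrices is the max norm. *)
Definition enorm n (v : 'cV[F]_n) : F := Num.sqrt (\sum_(i < n) v i 0 ^+ 2).

Definition posdef n (M : 'M[F]_n) : Prop :=
  M^T = M /\ forall x : 'cV[F]_n, x != 0 -> 0 < (x^T *m M *m x) 0 0.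

Definition negdef n (M : 'M[F]_n) : Prop := posdef (- M).

Definition lmi_matrix n (h gm : F) (A A1 P R S P2 P3 P4 : 'M[F]_n) :
    'M[F]_((n + n) + (n + n)) :=
  let W11 := A^T *m P2 + P2^T *m A + S - R + (gm ^+ 2)%:M in
  let W12 := P - P2^T + A^T *m P3 in
  let W13 := P2^T *m A1 + R in
  let W14 := P2^T + A^T *m P4 in
  let W22 := - P3 - P3^T + h ^+ 2 *: R in
  let W23 := P3^T *m A1 in
  let W24 := P3^T - P4 in
  let W33 := - S - R in
  let W34 := A1^T *m P4 in
  let W44 := P4^T + P4 - 1%:M in
  block_mx (block_mx W11 W12 W12^T W22)
           (block_mx W13 W14 W23 W24)
           (block_mx W13 W14 W23 W24)^T
           (block_mx W33 W34 W34^T W44).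

End Matrices.

Section ComparisonFunctions.
Context {F : realType}.

(* Functions on [0, +oo[ are represented by functions on F of which only the
   restriction to [0, +oo[ matters.  Nonnegativity of the values follows from
   the other two conditions. *)
Definition classK (alpha : F -> F) : Prop :=
  [/\ {within `[0, +oo[, continuous alpha},
      forall x y, 0 <= x -> x < y -> alpha x < alpha y
    & alpha 0 = 0].

Definition classKinf (alpha : F -> F) : Prop :=
  classK alpha /\ (alpha x @[x --> +oo%R] --> +oo%R).

Definition classKL (beta : F -> F -> F) : Prop :=
  (forall t, 0 <= t -> classK (beta^~ t)) /\
  (forall x, 0 <= x ->
    [/\ {within `[0, +oo[, continuous (beta x)},
        forall s t, 0 <= s -> s <= t -> beta x t <= beta x s
      & beta x t @[t --> +oo%R] --> (0 : F)]).

End ComparisonFunctions.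

Section TimeDelaySystems.
Context {F : realType}.

Definition abs_continuous (V : normedModType F) (a b : F) (f : F -> V) : Prop :=
  forall eps : F, 0 < eps -> exists2 delta : F, 0 < delta &
    forall (m : nat) (x y : 'I_m -> F),
      (forall i, a <= x i /\ x i <= y i /\ y i <= b) ->
      trivIset setT (fun i => `]x i, y i[%classic) ->
      \sum_(i < m) (y i - x i) < delta ->
      \sum_(i < m) `|f (y i) - f (x i)| < eps.

(* Measurability with respect to the Lebesgue (completed Borel) sigma-algebra,
   the one on which completed_lebesgue_measure is defined. *)
Definition lebesgue_measurable_input n (w : F -> 'cV[F]_n) : Prop :=
  forall i : 'I_n,
    measurable_fun (`[0, +oo[%classic :
        set (caratheodory_type ((@wlength F idfun)^*)%mu))
      (fun t => w t i 0).

(* Extending the norm by 0 to negative times does not change its essential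
   supremum, as the norm is nonnegative. *)
Definition ess_norm n (w : F -> 'cV[F]_n) : \bar F :=
  ess_sup (@lebesgue_measure F)
    (fun t => (if 0 <= t then enorm (w t) else 0)%:E).

(* For continuous phi, the supremum is attained. *)
Definition hist_norm n (h : F) (phi : F -> 'cV[F]_n) : F :=
  sup [set enorm (phi theta) | theta in `[- h, 0]].

(* The segment e_t; set to 0 outside [-h, 0] so that a functional applied to it
   depends on no other value of e. *)
Definition segment n (h : F) (e : F -> 'cV[F]_n) (t : F) : F -> 'cV[F]_n :=
  patch (fun=> 0) `[- h, 0] (fun theta => e (t + theta)).

(* Right-hand side (t, e_t, w(t)) |-> f t e_t (w t). *)
Definition delay_system n p :=
  F -> (F -> 'cV[F]_n) -> 'cV[F]_p -> 'cV[F]_n.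

(* Caratheodory solution on [0, T[, where T may be +oo. *)
Definition is_solution n p (h : F) (f : delay_system n p)
    (e0 : F -> 'cV[F]_n) (w : F -> 'cV[F]_p) (T : \bar F)
    (e : F -> 'cV[F]_n) : Prop :=
  [/\ forall theta, - h <= theta <= 0 -> e theta = e0 theta,
      forall t, 0 <= t -> (t%:E < T)%E -> abs_continuous 0 t e
    & {ae (@lebesgue_measure F), forall t, 0 < t -> (t%:E < T)%E ->
        is_derive t 1 e (f t (segment h e t) (w t))}].

(* The estimate is required of every solution, also of those that exist only
   on a bounded interval: quantifying over global solutions only would make
   systems with finite escape time vacuously stable.  An input with infinite
   essential supremum norm imposes no condition. *)
Definition ISS n p (h : F) (f : delay_system n p) : Prop :=
  exists (beta : F -> F -> F) (mu : F -> F),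
    [/\ classKL beta, classK mu &
      forall (e0 : F -> 'cV[F]_n) (w : F -> 'cV[F]_p),
        {within `[- h, 0], continuous e0} ->
        lebesgue_measurable_input w -> (ess_norm w < +oo)%E ->
      forall (T : \bar F) (e : F -> 'cV[F]_n), is_solution h f e0 w T e ->
      forall t, 0 <= t -> (t%:E < T)%E ->
        enorm (e t) <= beta (hist_norm h e0) t + mu (fine (ess_norm w))].

Definition closed_loop n p (f : delay_system n p)
    (kappa : 'cV[F]_n -> F -> 'cV[F]_p) : delay_system n p :=
  fun t phi v => f t phi (kappa (phi 0) t + v).

Definition gain_margin n p (h : F) (f : delay_system n p) (rho : F -> F) :=
  classKinf rho /\
  forall kappa : 'cV[F]_n -> F -> 'cV[F]_p,
    (forall xi t, enorm (kappa xi t) <= rho (enorm xi)) ->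
    ISS h (closed_loop f kappa).

Definition linear_delay_system n (h : F) (A A1 : 'M[F]_n) :
    delay_system n n :=
  fun _ phi w => A *m phi 0 + A1 *m phi (- h) + w.

End TimeDelaySystems.

(* Main.v *)
Require Import Defs.
From HB Require Import structures.
From mathcomp Require Import all_boot all_order all_algebra.
From mathcomp Require Import all_classical all_reals all_analysis.
From mathcomp Require Import ess_sup_inf ring lra.

Set Implicit Arguments.
Unset Strict Implicit.
Unset Printing Implicit Defensive.

Import Order.TTheory GRing.Theory Num.Theory.
Import numFieldNormedType.Exports.

(** Why the theorem holds.

A feedback [kappa] bounded by [gm * |xi|] together with an input [w] adds to the delay
equation a perturbation [d] with [|d| <= gm * |e| + |w|_oo].  Both claims therefore
follow from one estimate, uniform in [kappa], for curves [x] such that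
[|x' - A x - A1 x(t - h)| <= gm * |x| + u]; the uncontrolled system is the case
[kappa = 0].

For continuously differentiable [x] the estimate comes from the Lyapunov-Krasovskii
functional whose value at time [t] is the sum of [x^T P x], of the integral of
[x^T S x] over the window [[t - h, t]], and of the integral over the same window of
[(s - t + h) * (h * x'^T R x' + kap * (|x|^2 + |x'|^2))].  Jensen's inequality
([jensen_window]) bounds from below what leaves the last window, through the increment
[x(t) - x(t - h)].
The derivative of the functional without the [kap] terms is then at most the quadratic form of
[W] at [(x, x', x(t - h), d)] plus [|d|^2 - gm^2 * |x|^2] ([lmi_form]): the free matrices
[P2, P3, P4] multiply the zero vector [A x + A1 x(t - h) + d - x'].  As [W] is strictly
negative, a term [- c * (|x|^2 + |x'|^2)] survives ([lmi_dissipation]); the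
small weight [kap] converts part of it into the decay of the window integrals, and the
functional decays exponentially up to a multiple of [u^2] ([krasovskii_decay]).  This
argument starts at time [h], when the window no longer meets the initial function, which need
not be differentiable; before that, Gronwall's inequality suffices
([first_delay_interval]).

A solution is only absolutely continuous and its derivative exists only almost everywhere.
Rather than integrating that derivative, one replaces the solution [e] by its
averages over [[s, s + d]].  They are continuously differentiable, and they satisfy the
same differential inequality up to an error that vanishes with [d] ([steklov_estimate]).
The derivative of [e] enters only through a mean value inequality for absolutely
continuous curves ([ac_mean_value]), which rests on the fact that an absolutely continuous
function with nonpositive derivative almost everywhere is nonincreasing
([ac_ae_nonincreasing]).  Letting [d] tend to 0 gives the estimate for [e]
([delay_inclusion_estimate]). *)

Local Open Scope classical_set_scope.
Local Open Scope ring_scope.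

(** * Monotonicity of absolutely continuous functions *)

(** A property that holds at [a] and propagates across a neighbourhood of each point of
[[a, b]] holds at [b]: otherwise it would also hold beyond the supremum of the points where it
holds.  This replaces compactness arguments. *)
Lemma real_induction (F : realType) (P : F -> Prop) (a b : F) :
  a <= b -> P a ->
  (forall x, a <= x <= b -> exists2 r, 0 < r & forall s t,
     a <= s <= x -> x - r < s -> x <= t <= b -> t < x + r -> P s -> P t) ->
  P b.
Proof.
move=> ab Pa step; pose S := [set s | a <= s <= b /\ P s].
have Sa : S a by split=> //; rewrite lexx.
have hS : has_sup S.
  by split; [exists a | exists b => s [/andP[]]].
pose c := sup S.
have ac : a <= c by apply: ub_le_sup => //; exact: hS.2.
have cb : c <= b by apply: ge_sup; [exists a | move=> s [/andP[]]].
have [|r r0 H] := step c; first by rewrite ac.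
have [s [/andP[as_ sb] Ps] sc] := sup_adherent r0 hS.
have scle : s <= c by apply: ub_le_sup; [exact: hS.2 | split=> //; rewrite as_].
have Pt t : c <= t <= b -> t < c + r -> P t.
  by move=> ctb tr; apply: (H s t) => //; rewrite as_.
have [cb'|] := ltP c b; last first.
  by move=> bc; have -> : b = c by [lra]; apply: Pt; [rewrite lexx|rewrite ltrDl].
pose t := Num.min b (c + r / 2).
have ct : c < t by rewrite /t lt_min cb'/= ltrDl divr_gt0.
have tb : t <= b by rewrite /t ge_min lexx.
have tr : t < c + r by rewrite /t gt_min; apply/orP; right; lra.
have St : S t.
  by split; [rewrite tb (le_trans ac (ltW ct)) | apply: Pt; rewrite ?tb ?ltW].
by have := ub_le_sup hS.2 St; rewrite leNgt ct.
Qed.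

Lemma is_derive_eps (F : realType) (f : F -> F) (x df e : F) :
  is_derive x 1 f df -> 0 < e -> exists2 r, 0 < r & forall y, `|y - x| < r ->
    `|f y - f x - df * (y - x)| <= e * `|y - x|.
Proof.
move=> fdf e0; have [/= fx dfE] := fdf.
have := fx; rewrite /derivable => /cvg_ex[/= l fl].
have <- : l = df by rewrite -dfE; apply/esym/cvg_lim.
move/cvgrPdist_le : fl => /(_ _ e0)[/= r r0 Hr].
exists r => // y yr; have [->|yx] := eqVneq y x; first by rewrite !subrr mulr0 subrr normr0 mulr0.
have := Hr (y - x); rewrite /= sub0r normrN => /(_ yr).
rewrite subr_eq0 => /(_ yx); rewrite [_%:A]mulr1 subrK => H.
have -> : f y - f x - l * (y - x) = - (l - (y - x)^-1 *: (f y - f x)) * (y - x).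
  by rewrite /GRing.scale/=; field; rewrite subr_eq0.
by rewrite normrM normrN ler_wpM2r.
Qed.

Section MonotoneAC.
Context {F : realType}.
Local Notation mu := (@lebesgue_measure F).

(** The exceptional null set lies in an open set [U] of measure less than the modulus [d] of
absolute continuity for [e / 2].  Moving from [a] to [b], a point outside [U] lets [f] increase at
slope at most [e1], while an interval around a point of [U] is put aside.  The
intervals put aside are disjoint and contained in [U], so [f] increases by less than [e / 2]
on them altogether. *)
Lemma ac_ae_nonincreasing (f : F -> F) (a b : F) :
  a <= b -> abs_continuous a b (f : F -> F^o) ->
  {ae mu, forall t, a < t < b -> exists2 df, df <= 0 & is_derive t 1 f df} ->
  f b <= f a.
Proof.
move=> ab acf [N0 [mN0 N00 N0sub]].
(* the endpoints, where nothing is known of the derivative, are added to the null set *)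
pose N := N0 `|` [set a; b].
have mN : measurable N by apply: measurableU => //; apply: measurableU.
have muN : (mu N = 0)%E.
  apply/negligibleP => //; apply: negligibleU; first exact/negligibleP.
  by apply: negligibleU; apply/negligibleP => //; exact: lebesgue_measure_set1.
have Ngood t : a <= t <= b -> ~ N t -> exists2 df, df <= 0 & is_derive t 1 f df.
  move=> /andP[at_ tb] Nt; apply: contrapT => H; apply: Nt.
  have [ta|ta] := eqVneq t a; first by right; left.
  have [tb'|tb'] := eqVneq t b; first by right; right.
  left; apply: N0sub => /= K; apply: H; apply: K.
  by rewrite !lt_neqAle at_ tb tb' eq_sym ta.
apply/ler_addgt0Pr => e e0.
pose e1 := e / 2 / (b - a + 1).
have e10 : 0 < e1 by rewrite !divr_gt0//; lra.
have [d d0 Hd] := acf _ (divr_gt0 e0 (ltr0n F 2)).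
have [|U [oU NU muU]] := lebesgue_regularity_outer mN _ d0.
  by apply: (@le_lt_trans _ _ 0%E); [rewrite -muN | exact: ltry].
have mU : measurable U by exact: measurable_realfun.open_measurable.
have {}muU : (mu U < d%:E)%E.
  apply: le_lt_trans muU.
  rewrite -[leRHS]adde0 -muN -measureU ?setDKU//; first exact: measurableD.
  by apply/seteqP; split=> // x [[]].
(* [t] is reached from [a]; the [m] intervals are those put aside on the way *)
pose P t := exists (m : nat) (x y : nat -> F),
  [/\ forall i, (i < m)%N -> a <= x i /\ x i <= y i /\ y i <= t,
      forall i j, (i < j < m)%N -> y i <= x j,
      ((\sum_(i < m) (y i - x i))%:E <= mu (U `&` `]a, t]))%E
    & f t - f a <= e1 * (t - a) + \sum_(i < m) `|f (y i) - f (x i)| ].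
have : P b.
  apply: real_induction ab _ _.
    exists 0, (fun=> 0), (fun=> 0); split=> //.
    - by rewrite big_ord0; apply: measure_ge0.
    - by rewrite big_ord0; lra.
  move=> x xab; have [Ux|NUx] := pselect (U x).
    have /nbhs_ballP[r /= r0 rU] := open_nbhs_nbhs (conj oU Ux).
    exists r => // s t /andP[as_ sx] xrs /andP[xt tb] txr.
    move=> [m [p [q [H1 H2 H3 H4]]]].
    pose p' i := if i == m then s else p i; pose q' i := if i == m then t else q i.
    have sumS (g : F -> F -> F) : \sum_(i < m.+1) g (p' i) (q' i) =
        \sum_(i < m) g (p i) (q i) + g s t.
      rewrite big_ord_recr/= /p' /q' eqxx; congr (_ + _).
      by apply: eq_bigr => i _; rewrite ltn_eqF.
    exists m.+1, p', q'; split.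
    - move=> i; rewrite ltnS leq_eqVlt /p' /q'; case: eqVneq => /= [_ _|_ /H1].
        by do !split=> //; lra.
      by move=> [? [? ?]]; do !split=> //; lra.
    - move=> i j /andP[ij jm]; rewrite /p' /q'.
      have im : (i < m)%N by rewrite (leq_trans ij).
      rewrite (ltn_eqF im); move: jm; rewrite ltnS leq_eqVlt.
      case: eqVneq => /= [_ _|_ jm]; first by have [_ []] := H1 _ im.
      by apply: H2; rewrite ij.
    - rewrite (sumS (fun u v => v - u)) EFinD.
      have st : s <= t by lra.
      have -> : (t - s)%:E = mu `]s, t].
        rewrite lebesgue_measure_itv/= lte_fin; case: ltP => [_|ts]; first by rewrite EFinB.
        by have -> : t = s by [lra]; rewrite subrr.
      apply: (@le_trans _ _ (mu (U `&` `]a, s]) + mu `]s, t])%E); first exact: leeD2r.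
      rewrite -measureU//; last first.
        apply/seteqP; split=> // z [[_ /=]]; rewrite !in_itv/=.
          by move=> /andP[_ zs] /andP[/lt_le_trans/(_ zs)]; rewrite ltxx.
      + by apply: measurableI.
      + apply: le_measure; rewrite ?inE.
        * by apply: measurableU => //; exact: measurableI.
        * exact: measurableI.
        * move=> z [[Uz]|] /=; rewrite in_itv/= => /andP[z1 z2].
            by split=> //=; rewrite in_itv/=; lra.
          split; last by rewrite /= in_itv/=; lra.
          by apply: rU; rewrite /ball/= ltr_norml; lra.
    - rewrite (sumS (fun u v => `|f v - f u|)).
      have := ler_norm (f t - f s); have : 0 <= e1 * (t - s) by rewrite mulr_ge0//; lra.
      lra.
  have [|df df0 fdf] := Ngood x xab; first by move=> /NU.
  have [r r0 Hr] := is_derive_eps fdf e10.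
  exists r => // s t /andP[as_ sx] xrs /andP[xt tb] txr [m [p [q [H1 H2 H3 H4]]]].
  exists m, p, q; split=> //.
  - by move=> i /H1 [? [? qs]]; do !split=> //; lra.
  - apply: le_trans H3 _; apply: le_measure; rewrite ?inE; [exact: measurableI..|].
    apply: setIS => z /=; rewrite !in_itv /= => /andP[-> zs] /=; lra.
  - have := Hr s; have := Hr t; rewrite !ler_norml !ltr_norml => /(_ _)/andP[|_ A1].
      lra.
    move=> /(_ _)/andP[|A2 _]; first lra.
    rewrite (ger0_norm (_ : 0 <= t - x)) in A1; last lra.
    rewrite (ler0_norm (_ : s - x <= 0)) in A2; last lra.
    have : df * (t - s) <= 0 by rewrite mulr_le0_ge0//; lra.
    lra.
move=> [m [x [y [H1 H2 H3 H4]]]].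
have H5 : \sum_(i < m) (y i - x i) < d.
  by rewrite -lte_fin (le_lt_trans H3)// (le_lt_trans _ muU)// le_measure ?inE//;
    exact: measurableI.
have := Hd m (fun i => x i) (fun i => y i) _ _ H5.
have H6 : e1 * (b - a) <= e / 2.
  rewrite /e1 mulrAC -mulrA ler_piMr//; first lra.
  by rewrite ler_pdivrMr; lra.
suff K : \sum_(i < m) `|f (y i) - f (x i)| < e / 2 by lra.
apply: (Hd m (fun i => x i) (fun i => y i)) => //; first by move=> i; exact: H1.
have disj (i j : nat) : (i < j < m)%N -> `]x i, y i[ `&` `]x j, y j[ = set0.
  move=> ijm; apply/seteqP; split=> // z [] /=; rewrite !in_itv/=.
  move=> /andP[_ zy] /andP[xz _]; have := H2 _ _ ijm.
  by move=> /le_lt_trans/(_ xz)/lt_trans/(_ zy); rewrite ltxx.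
apply/trivIsetP => /= i j _ _; rewrite -(inj_eq val_inj) neq_ltn => /orP[ij|ji].
  by apply: disj; rewrite ij/=.
by rewrite setIC; apply: disj; rewrite ji/=.
Qed.

End MonotoneAC.

(** * Euclidean geometry and quadratic forms *)

Section DotProduct.
Context {F : realType}.

Definition dotv n (x y : 'cV[F]_n) : F := \sum_(i < n) x i 0 * y i 0.

Definition sqn n (x : 'cV[F]_n) : F := dotv x x.

Lemma dotvC n (x y : 'cV[F]_n) : dotv x y = dotv y x.
Proof. by apply: eq_bigr => i _; rewrite mulrC. Qed.

Lemma dotvDr n (x y z : 'cV[F]_n) : dotv x (y + z) = dotv x y + dotv x z.
Proof. by rewrite /dotv -big_split; apply: eq_bigr => i _; rewrite mxE mulrDr. Qed.

Lemma dotvNr n (x y : 'cV[F]_n) : dotv x (- y) = - dotv x y.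
Proof. by rewrite /dotv -sumrN; apply: eq_bigr => i _; rewrite mxE mulrN. Qed.

Lemma dotvZr n a (x y : 'cV[F]_n) : dotv x (a *: y) = a * dotv x y.
Proof. by rewrite /dotv mulr_sumr; apply: eq_bigr => i _; rewrite mxE mulrCA. Qed.

Lemma dotvDl n (x y z : 'cV[F]_n) : dotv (x + y) z = dotv x z + dotv y z.
Proof. by rewrite dotvC dotvDr !(dotvC z). Qed.

Lemma dotvNl n (x y : 'cV[F]_n) : dotv (- x) y = - dotv x y.
Proof. by rewrite dotvC dotvNr dotvC. Qed.

Lemma dotvZl n a (x y : 'cV[F]_n) : dotv (a *: x) y = a * dotv x y.
Proof. by rewrite dotvC dotvZr dotvC. Qed.

Lemma dotvM m n (M : 'M[F]_(m, n)) x y : dotv x (M *m y) = dotv (M^T *m x) y.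
Proof.
rewrite /dotv; under eq_bigr do rewrite mxE mulr_sumr.
rewrite exchange_big; apply: eq_bigr => j _ /=; rewrite mxE mulr_suml.
by apply: eq_bigr => i _; rewrite !mxE mulrCA mulrA.
Qed.

Lemma dotv_col m n (x : 'cV[F]_m) (y : 'cV[F]_n) x' y' :
  dotv (col_mx x y) (col_mx x' y') = dotv x x' + dotv y y'.
Proof.
rewrite /dotv big_split_ord; congr (_ + _); apply: eq_bigr => i _.
  by rewrite !col_mxEu.
by rewrite !col_mxEd.
Qed.

Lemma mx11_dotv n (M : 'M[F]_n) (x y : 'cV[F]_n) :
  (x^T *m M *m y) 0 0 = dotv x (M *m y).
Proof. by rewrite -mulmxA mxE; apply: eq_bigr => i _; rewrite mxE. Qed.

Lemma sqn_ge0 n (x : 'cV[F]_n) : 0 <= sqn x.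
Proof. by apply: sumr_ge0 => i _; rewrite -expr2 sqr_ge0. Qed.

Lemma enormE n (x : 'cV[F]_n) : enorm x = Num.sqrt (sqn x).
Proof. by congr Num.sqrt; apply: eq_bigr => i _; rewrite expr2. Qed.

Lemma enorm_ge0 n (x : 'cV[F]_n) : 0 <= enorm x.
Proof. exact: sqrtr_ge0. Qed.

Lemma sqr_enorm n (x : 'cV[F]_n) : enorm x ^+ 2 = sqn x.
Proof. by rewrite enormE sqr_sqrtr// sqn_ge0. Qed.

Lemma sqnD n (x y : 'cV[F]_n) : sqn (x + y) = sqn x + 2 * dotv x y + sqn y.
Proof. by rewrite /sqn dotvDl !dotvDr (dotvC y x); ring. Qed.

Lemma sqnN n (x : 'cV[F]_n) : sqn (- x) = sqn x.
Proof. by rewrite /sqn dotvNl dotvNr opprK. Qed.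

Lemma sqnZ n a (x : 'cV[F]_n) : sqn (a *: x) = a ^+ 2 * sqn x.
Proof. by rewrite /sqn dotvZl dotvZr mulrA. Qed.

Lemma dotv_le n (x y : 'cV[F]_n) : 2 * dotv x y <= sqn x + sqn y.
Proof.
by have := sqn_ge0 (x - y); rewrite sqnD dotvNr sqnN; lra.
Qed.

Lemma sqnD_le n (x y : 'cV[F]_n) : sqn (x + y) <= 2 * sqn x + 2 * sqn y.
Proof. by rewrite sqnD; have := dotv_le x y; lra. Qed.

Lemma sqn_eq0 n (x : 'cV[F]_n) : sqn x = 0 -> x = 0.
Proof.
move=> /eqP; rewrite psumr_eq0; last by move=> i _; rewrite -expr2 sqr_ge0.
move=> /allP x0; apply/colP => i; rewrite mxE.
by have := x0 i; rewrite mem_index_enum mulf_eq0 orbb => /(_ isT)/eqP.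
Qed.

Lemma dotv0l n (y : 'cV[F]_n) : dotv 0 y = 0.
Proof. by rewrite /dotv big1// => i _; rewrite mxE mul0r. Qed.

Lemma cauchy_schwarz n (x y : 'cV[F]_n) : dotv x y ^+ 2 <= sqn x * sqn y.
Proof.
have [x0|x0] := eqVneq (sqn x) 0.
  by rewrite (sqn_eq0 x0) dotv0l /sqn dotv0l expr0n mul0r.
have xp : 0 < sqn x by rewrite lt_def x0 sqn_ge0.
have := sqn_ge0 (sqn x *: y - dotv x y *: x).
rewrite sqnD sqnN !sqnZ dotvNr dotvZl dotvZr (dotvC y x) => H.
suff : 0 <= sqn x * (sqn x * sqn y - dotv x y ^+ 2) by rewrite pmulr_rge0// subr_ge0.
by lra.
Qed.

Lemma dotv_le_enorm n (x y : 'cV[F]_n) : dotv x y <= enorm x * enorm y.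
Proof.
rewrite (le_trans (ler_norm _))// -(@ler_pXn2r _ 2)// ?nnegrE ?mulr_ge0 ?enorm_ge0//.
by rewrite exprMn !sqr_enorm real_normK ?num_real// cauchy_schwarz.
Qed.

Lemma ler_enormD n (x y : 'cV[F]_n) : enorm (x + y) <= enorm x + enorm y.
Proof.
rewrite -(@ler_pXn2r _ 2)// ?nnegrE ?addr_ge0 ?enorm_ge0//.
rewrite sqr_enorm sqnD; have := dotv_le_enorm x y.
have := sqr_enorm x; have := sqr_enorm y; nra.
Qed.

Lemma enorm_coord n (x : 'cV[F]_n) i : `|x i 0| <= enorm x.
Proof.
rewrite -(@ler_pXn2r _ 2)// ?nnegrE ?enorm_ge0// sqr_enorm real_normK ?num_real//.
rewrite /sqn /dotv (bigD1 i)//= -expr2 lerDl sumr_ge0// => j _.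
by rewrite -expr2 sqr_ge0.
Qed.

(** The factor [n] is not sharp, but avoids a square root. *)
Lemma enorm_le_coord n (x : 'cV[F]_n) (r : F) : 0 <= r ->
  (forall i, `|x i 0| <= r) -> enorm x <= n%:R * r.
Proof.
move=> r0 xr; rewrite -(@ler_pXn2r _ 2)// ?nnegrE ?mulr_ge0 ?enorm_ge0//.
rewrite sqr_enorm /sqn /dotv (@le_trans _ _ (\sum_(i < n) r ^+ 2))//.
  by apply: ler_sum => i _; rewrite -expr2 -real_normK ?num_real// lerXn2r ?nnegrE.
rewrite sumr_const card_ord exprMn -[leLHS]mulr_natl ler_wpM2r ?sqr_ge0//.
by rewrite -natrX ler_nat; case: (n) => // k; rewrite leq_pmulr.
Qed.

Lemma sqn_mulmx_le m n (M : 'M[F]_(m, n)) :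
  exists2 C, 0 <= C & forall x, sqn (M *m x) <= C * sqn x.
Proof.
exists (\sum_(i < m) sqn (row i M)^T) => [|x].
  by apply: sumr_ge0 => i _; exact: sqn_ge0.
rewrite mulr_suml; apply: ler_sum => i _; rewrite -expr2.
rewrite (le_trans _ (cauchy_schwarz _ _))// le_eqVlt; apply/orP; left; apply/eqP.
by congr (_ ^+ 2); rewrite mxE; apply: eq_bigr => j _; rewrite !mxE.
Qed.

Lemma dotv_mulmx_le n (M : 'M[F]_n) :
  exists2 C, 0 <= C & forall x, dotv x (M *m x) <= C * sqn x.
Proof.
have [C C0 HC] := sqn_mulmx_le M; exists (C + 1); first lra.
move=> x; have := dotv_le x (M *m x); have := HC x; have := sqn_ge0 x.
have := sqn_ge0 (M *m x); nra.
Qed.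

Lemma continuous_dotv (T : topologicalType) n (f g : T -> 'cV[F]_n) :
  (forall i, continuous (fun t => f t i 0)) ->
  (forall i, continuous (fun t => g t i 0)) ->
  continuous (fun t => dotv (f t) (g t)).
Proof.
move=> cf cg; rewrite /dotv; apply: continuous_big => [|i _ t].
  exact: add_continuous.
by apply: continuousM; [exact: cf | exact: cg].
Qed.

Lemma continuous_mulmx (T : topologicalType) m n (M : 'M[F]_(m, n)) (f : T -> 'cV[F]_n) :
  (forall i, continuous (fun t => f t i 0)) ->
  forall i, continuous (fun t => (M *m f t) i 0).
Proof.
move=> cf i; under eq_fun do rewrite mxE.
apply: continuous_big => [|j _ t]; first exact: add_continuous.
by apply: continuousM; [exact: cvg_cst | exact: cf].
Qed.

(** Positivity on the unit sphere is uniform because the sphere is compact;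
homogeneity carries the bound to all vectors. *)
Lemma posdef_coercive n (M : 'M[F]_n) : posdef M ->
  exists2 c, 0 < c & forall x, c * sqn x <= dotv x (M *m x).
Proof.
move=> [_ Mpos].
have pos x : x != 0 -> 0 < dotv x (M *m x) by move=> /Mpos; rewrite mx11_dotv.
pose tr (v : 'rV[F]_n) := v^T.
have ctr i : continuous (fun v : 'rV[F]_n => tr v i 0).
  by move=> v; under eq_fun do rewrite mxE; exact: coord_continuous.
pose S := [set v : 'rV[F]_n | sqn v^T = 1].
have clS : closed S.
  apply: (@preimage_closed _ _ (fun v : 'rV[F]_n => sqn v^T) [set x : F | x = 1]).
    by move=> v _; exact: (continuous_dotv ctr ctr).
  exact: closed_eq.
have bS : bounded_set S.
  exists 1; split; first exact: num_real.
  move=> r r1 v Sv /=; rewrite [leLHS]/Num.Def.normr/= mx_normrE.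
  apply: bigmax_le => [|[i j] _ /=]; first by lra.
  have -> : v i j = v^T j 0 by rewrite mxE (ord1 i).
  by rewrite (le_trans (enorm_coord _ _))// enormE Sv sqrtr1 ltW.
(* the sphere is empty in dimension 0 *)
have [S0|/set0P S0] := eqVneq S set0.
  exists 1 => // x; rewrite mul1r.
  have [->|x0] := eqVneq x 0; first by rewrite /sqn !dotv0l.
  have s0 : 0 < sqn x.
    by rewrite lt_def sqn_ge0 andbT; apply: contra x0 => /eqP/sqn_eq0/eqP.
  suff : S ((enorm x)^-1 *: x)^T by rewrite S0.
  by rewrite /S/= trmxK sqnZ exprVn sqr_enorm mulVf// gt_eqF.
have cq : continuous (fun v : 'rV[F]_n => dotv (tr v) (M *m tr v)).
  by apply: continuous_dotv => //; exact: continuous_mulmx.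
have [v Sv vmin] := compact_EVT_min S0 (bounded_closed_compact bS clS) (continuous_subspaceT cq).
exists (dotv (tr v) (M *m tr v)).
  apply: pos; apply/eqP => v0; move: Sv; rewrite inE /S/= -/(tr v) v0 /sqn dotv0l.
  by move/eqP; rewrite eq_sym oner_eq0.
move=> x; have [->|x0] := eqVneq x 0; first by rewrite /sqn !dotv0l mulr0.
have s0 : 0 < sqn x.
  by rewrite lt_def sqn_ge0 andbT; apply: contra x0 => /eqP/sqn_eq0/eqP.
have := vmin ((enorm x)^-1 *: x)^T; rewrite inE {1}/S/= /tr trmxK sqnZ exprVn sqr_enorm.
rewrite mulVf ?gt_eqF// => /(_ erefl).
rewrite -scalemxAr dotvZl dotvZr mulrA -expr2 exprVn sqr_enorm mulrC.
by rewrite ler_pdivlMr.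
Qed.

(** The off-diagonal blocks come in transposed pairs, whose two members contribute equally. *)
Lemma dotv_block4 n (a b c d e f g k l m : 'M[F]_n) (x y z w : 'cV[F]_n) :
  let X := col_mx (col_mx x y) (col_mx z w) in
  dotv X (block_mx (block_mx a b b^T c) (block_mx d e f g)
    (block_mx d e f g)^T (block_mx k l l^T m) *m X) =
  dotv x (a *m x) + dotv y (c *m y) + dotv z (k *m z) + dotv w (m *m w)
  + 2 * (dotv x (b *m y) + dotv x (d *m z) + dotv x (e *m w)
         + dotv y (f *m z) + dotv y (g *m w) + dotv z (l *m w)).
Proof.
have tr (M : 'M[F]_n) u v : dotv u (M^T *m v) = dotv v (M *m u).
  by rewrite dotvM trmxK dotvC.
rewrite /= mul_block_col dotv_col.
rewrite tr_block_mx !mul_block_col !add_col_mx !dotv_col !dotvDr !tr.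
by ring.
Qed.

(** Substituting the equation for [y] removes [P2], [P3] and [P4]: they enter only through
[2 * (P2 x + P3 y + P4 d)^T (A x + A1 z + d - y)], which is zero. *)
Lemma lmi_form n (h gm : F) (A A1 P R S P2 P3 P4 : 'M[F]_n) (x y z d : 'cV[F]_n) :
  R^T = R -> y = A *m x + A1 *m z + d ->
  let X := col_mx (col_mx x y) (col_mx z d) in
  dotv X (lmi_matrix h gm A A1 P R S P2 P3 P4 *m X) =
    2 * dotv x (P *m y) + dotv x (S *m x) - dotv z (S *m z)
    + h ^+ 2 * dotv y (R *m y) - dotv (x - z) (R *m (x - z))
    + gm ^+ 2 * sqn x - sqn d.
Proof.
move=> RT yE X; rewrite /lmi_matrix /X dotv_block4.
have tr (M : 'M[F]_n) u v : dotv u (M^T *m v) = dotv v (M *m u).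
  by rewrite dotvM trmxK dotvC.
have trM (M N : 'M[F]_n) u v : dotv u (M^T *m N *m v) = dotv (N *m v) (M *m u).
  by rewrite -mulmxA tr.
have Rzx : dotv z (R *m x) = dotv x (R *m z) by rewrite -{1}RT tr.
have sc a (u : 'cV[F]_n) : dotv u (a%:M *m u) = a * sqn u.
  by rewrite mul_scalar_mx dotvZr.
rewrite !(mulmxDl, mulNmx, mulmxBl, dotvDr, dotvNr) !trM !tr sc mul1mx -scalemxAl dotvZr.
rewrite mulmxDr mulmxN dotvDl dotvNl !dotvDr !dotvNr Rzx.
(* the free multipliers enter through the zero vector A x + A1 z + d - y *)
have Z u : dotv y u = dotv (A *m x) u + dotv (A1 *m z) u + dotv d u.
  by rewrite yE !dotvDl.
have := Z (P2 *m x); have := Z (P3 *m y); have := Z (P4 *m d).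
rewrite -[dotv d d]/(sqn d).

rewrite !(dotvC (A *m _)) !(dotvC (A1 *m _)).
lra.
Qed.
End DotProduct.

(** * Derivatives, antiderivatives and the Gronwall inequality *)

Section ScalarCalculus.
Context {F : realType}.
Implicit Types f g : F -> F.

Lemma is_derive_const (c t : F) : is_derive t 1 (fun=> c : F) 0.
Proof. exact: is_derive_cst. Qed.

Lemma is_derive_add f g (t a b : F) : is_derive t 1 f a -> is_derive t 1 g b ->
  is_derive t 1 (fun s => f s + g s) (a + b).
Proof. by move=> fa gb; exact: (is_deriveD fa gb). Qed.

Lemma is_derive_sub f g (t a b : F) : is_derive t 1 f a -> is_derive t 1 g b ->
  is_derive t 1 (fun s => f s - g s) (a - b).
Proof. by move=> fa gb; exact: (is_deriveB fa gb). Qed.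

Lemma is_derive_mul f g (t a b : F) : is_derive t 1 f a -> is_derive t 1 g b ->
  is_derive t 1 (fun s => f s * g s) (a * g t + f t * b).
Proof.
move=> fa gb; apply: (is_derive_eq (is_deriveM fa gb)).
by rewrite /GRing.scale/= addrC [g t * a]mulrC.
Qed.

Lemma is_derive_scale c f (t a : F) : is_derive t 1 f a ->
  is_derive t 1 (fun s => c * f s) (c * a).
Proof. by move=> fa; exact: (is_deriveZ c fa). Qed.

Lemma is_derive_linear (c t : F) : is_derive t 1 (fun s => c * s) c.
Proof. by apply: (is_derive_eq (is_derive_scale c (is_derive_id t 1))); rewrite mulr1. Qed.

Lemma is_derive_translate f (c t a : F) : is_derive (t + c) 1 f a ->
  is_derive t 1 (fun s => f (s + c)) a.
Proof.
move=> fa; have sh := is_derive_shift t 1 c.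
by apply: (is_derive_eq (@is_derive1_comp _ f (shift c) t a 1 fa sh)); rewrite mulr1.
Qed.

Lemma is_derive_bigsum n (h : 'I_n -> F -> F) (dh : 'I_n -> F) (t : F) :
  (forall i, is_derive t 1 (h i) (dh i)) ->
  is_derive t 1 (fun s => \sum_(i < n) h i s) (\sum_(i < n) dh i).
Proof.
move=> hd; have -> : (fun s => \sum_(i < n) h i s) = \sum_(i < n) h i.
  by apply/funext => s; rewrite fct_sumE.
exact: is_derive_sum.
Qed.

Lemma is_derive_continuous f (t a : F) : is_derive t 1 f a -> {for t, continuous f}.
Proof. by move=> [fa _]; exact/differentiable_continuous/derivable1_diffP. Qed.

Lemma mean_value f df (a b : F) : a <= b ->
  (forall t, a <= t <= b -> is_derive t 1 f (df t)) ->
  exists2 c, a <= c <= b & f b - f a = df c * (b - a).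
Proof.
move=> ab fd; have [||c cab ->] := @MVT_segment F f df a b ab.
- by move=> t; rewrite in_itv/= => /andP[a1 a2]; apply: fd; rewrite !ltW.
- apply: derivable_within_continuous => t; rewrite in_itv/= => tab.
  by have [] := fd t tab.
- by exists c.
Qed.

Lemma increment_le f df g dg (a b : F) : a <= b ->
  (forall t, a <= t <= b -> is_derive t 1 f (df t)) ->
  (forall t, a <= t <= b -> is_derive t 1 g (dg t)) ->
  (forall t, a <= t <= b -> df t <= dg t) ->
  f b - f a <= g b - g a.
Proof.
move=> ab fd gd dfg.
have [|c cab] := @mean_value (fun s => g s - f s) (fun s => dg s - df s) _ _ ab.
  by move=> t tab; apply: is_derive_sub; [exact: gd | exact: fd].
have := dfg _ cab; rewrite -subr_ge0 => /mulr_ge0 H; have {H} := H (b - a).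
by rewrite subr_ge0 => /(_ ab); lra.
Qed.

Lemma gronwall f df (m a b : F) : a <= b ->
  (forall t, a <= t <= b -> is_derive t 1 f (df t)) ->
  (forall t, a <= t <= b -> df t <= m * f t) ->
  f b <= expR (m * (b - a)) * f a.
Proof.
move=> ab fd dfm.
pose E s := expR (m * (a - s)).
have Ed (t : F) : is_derive t 1 (E : F -> F) (- m * E t).
  have lin : is_derive t 1 (fun s : F => m * (a - s)) (- m).
    have c1 : is_derive t 1 (fun=> a) 0 by exact: is_derive_cst.
    have c2 : is_derive t 1 (fun s : F => s) 1 by exact: is_derive_id.
    apply: (is_derive_eq (is_derive_scale m (is_derive_sub c1 c2))).
    by rewrite sub0r mulrN1.
  apply: (is_derive_eq (@is_derive1_comp _ expR _ t _ _ (is_derive_expR _) lin)).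
  by rewrite mulrC.
have : f b * E b - f a * E a <= 0 - 0 :> F.
  apply: (@increment_le (fun s => f s * E s) (fun s => df s * E s + f s * (- m * E s))
    (fun=> 0) (fun=> 0) a b ab) => t tab.
  - by apply: is_derive_mul => //; exact: fd.
  - rewrite (_ : _ + _ = (df t - m * f t) * E t); last by ring.
    by rewrite mulr_le0_ge0 ?expR_ge0// subr_le0 dfm.
rewrite subrr [E a]/E subrr mulr0 expR0 mulr1 subr_le0 => H.
have -> : f b = f b * E b * expR (m * (b - a)).
  by rewrite -mulrA -expRD (_ : _ + _ = 0) ?expR0 ?mulr1//; ring.
by rewrite mulrC ler_wpM2l// expR_ge0.
Qed.

Lemma antiderivative_right (r : F -> F) (a : F) : continuous r ->
  exists G : F -> F, forall t : F, a < t -> is_derive t 1 G (r t).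
Proof.
move=> cr; pose G y := (\int[lebesgue_measure]_(t in `[a, y]) r t)%R; exists G => t ta.
have ri : lebesgue_measure.-integrable `[a, t + 1] (EFin \o r).
  apply: continuous_compact_integrable; first exact: segment_compact.
  exact: continuous_subspaceT.
have tt : t < t + 1 by rewrite ltrDl.
have [Gd <-] := continuous_FTC1_closed tt ri ta (cr t).
by rewrite derive1E; exact: DeriveDef.
Qed.

(** Integrals from a fixed lower bound give antiderivatives on half-lines only.  Those on
[t > - n.+1], normalized to vanish at 0, agree where two of them are defined, and are glued. *)
Lemma antiderivative (r : F -> F) : continuous r ->
  exists G : F -> F, forall t : F, is_derive t 1 G (r t).
Proof.
move=> cr; have /choice[G Gd] := fun n : nat => antiderivative_right (- n.+1%:R) cr.
pose H n (t : F) : F := G n t - G n 0.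
have Hd n (t : F) : - n.+1%:R < t -> is_derive t 1 (H n) (r t).
  move=> nt; rewrite -[r t]subr0.
  by apply: is_derive_sub; exact: Gd.
have Hn0 n : - n.+1%:R < 0 :> F by rewrite oppr_lt0.
have Heq m n (t : F) : - m.+1%:R < t -> - n.+1%:R < t -> H m t = H n t.
  move=> mt nt; pose D (s : F) : F := H m s - H n s.
  have Dd (s : F) : - m.+1%:R < s -> - n.+1%:R < s -> is_derive s 1 D 0.
    by move=> ms ns; rewrite -[0](subrr (r s)); apply: is_derive_sub; exact: Hd.
  have D0 : D 0 = 0 by rewrite /D /H !subrr.
  suff : D t = D 0 by rewrite D0 => /subr0_eq.
  have [t0|t0] := leP 0 t.
    have [s /andP[s0 _]|s _] := @mean_value D (fun=> 0) 0 t t0.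
      by apply: Dd; apply: lt_le_trans s0; exact: Hn0.
    by rewrite mul0r => /subr0_eq.
  have [s /andP[st _]|s _] := @mean_value D (fun=> 0) t 0 (ltW t0).
    by apply: Dd; apply: lt_le_trans st.
  by rewrite mul0r => /subr0_eq.
pose N t := Num.bound `|t : F|.
have NP (t : F) : - (N t).+1%:R + 1 < t.
  by have := archi_boundP (normr_ge0 t); rewrite -natr1 -/(N t) ltr_norml => /andP[]; lra.
exists (fun t => H (N t) t) => t.
have tN : - (N t).+1%:R < t by have := NP t; lra.
apply: near_eq_is_derive (Hd _ _ tN).
near=> s; apply: Heq; last by have := NP s; lra.
near: s; exact: lt_nbhsr.
Unshelve. all: by end_near. Qed.

End ScalarCalculus.

Section VectorCalculus.
Context {F : realType}.

Lemma is_derive_dotv n (f g : F -> 'cV[F]_n) (t : F) (df dg : 'cV[F]_n) :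
  (forall i, is_derive t 1 (fun s => f s i 0) (df i 0)) ->
  (forall i, is_derive t 1 (fun s => g s i 0) (dg i 0)) ->
  is_derive t 1 (fun s => dotv (f s) (g s)) (dotv df (g t) + dotv (f t) dg).
Proof.
move=> fd gd; rewrite /dotv -big_split /=.
by apply: is_derive_bigsum => i; exact: is_derive_mul.
Qed.

Lemma is_derive_mulmx m n (M : 'M[F]_(m, n)) (f : F -> 'cV[F]_n)
  (t : F) (df : 'cV[F]_n) :
  (forall i, is_derive t 1 (fun s => f s i 0) (df i 0)) ->
  forall i, is_derive t 1 (fun s => (M *m f s) i 0) ((M *m df) i 0).
Proof.
move=> fd i; under eq_fun do rewrite mxE.
by rewrite mxE; apply: is_derive_bigsum => j; exact: is_derive_scale.
Qed.

End VectorCalculus.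

(** * Pointwise consequences of the matrix inequality *)

Section SmoothSystem.
Context {F : realType}.

Lemma rhs_bound n (A A1 : 'M[F]_n) (gm : F) : exists2 C, 0 <= C &
  forall x y z u, enorm (y - A *m x - A1 *m z) <= gm * enorm x + u ->
    sqn y <= C * (sqn x + sqn z + u ^+ 2).
Proof.
have [a a0 Ha] := sqn_mulmx_le A; have [b b0 Hb] := sqn_mulmx_le A1.
exists (4 * a + 4 * b + 4 * gm ^+ 2 + 4) => [|x y z u Hd].
  by have := sqr_ge0 gm; lra.
set d := y - A *m x - A1 *m z in Hd.
have -> : y = (A *m x + A1 *m z) + d by rewrite /d -(addrA y) -opprD [RHS]addrC subrK.
have D : sqn d <= 2 * (gm ^+ 2 * sqn x) + 2 * u ^+ 2.
  rewrite -!sqr_enorm; have := enorm_ge0 d.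
  have := sqr_ge0 (gm * enorm x - u); nra.
have := sqnD_le (A *m x + A1 *m z) d; have := sqnD_le (A *m x) (A1 *m z).
have := Ha x; have := Hb z; have := sqr_ge0 gm; have := sqr_ge0 u.
have := sqn_ge0 x; have := sqn_ge0 z.
move: (sqn (A *m x)) (sqn (A1 *m z)) (sqn (A *m x + A1 *m z)) (sqn _) D => *.
nra.
Qed.

(** The strict inequality [W < 0] leaves room for the cross term that appears when
the square of [gm * |x| + u] is compared with that of [gm * |x|]. *)
Lemma lmi_dissipation n (h gm : F) (A A1 P R S P2 P3 P4 : 'M[F]_n) :
  posdef R -> negdef (lmi_matrix h gm A A1 P R S P2 P3 P4) ->
  exists c K : F, [/\ 0 < c, 0 <= K &
    forall x y z u, 0 <= u ->
      enorm (y - A *m x - A1 *m z) <= gm * enorm x + u ->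
      2 * dotv x (P *m y) + dotv x (S *m x) - dotv z (S *m z)
      + h ^+ 2 * dotv y (R *m y) - dotv (x - z) (R *m (x - z)) <=
      - c * (sqn x + sqn y) + K * u ^+ 2].
Proof.
move=> [RT _] /posdef_coercive[c c0 Hc].
exists (c / 2), (1 + 2 * gm ^+ 2 / c); split; first by lra.
  have := divr_ge0 (sqr_ge0 gm) (ltW c0); lra.
move=> x y z u u0 Hd; set d := y - A *m x - A1 *m z in Hd.
have yE : y = A *m x + A1 *m z + d by rewrite /d -(addrA y) -opprD [RHS]addrC subrK.
have := Hc (col_mx (col_mx x y) (col_mx z d)).
rewrite mulNmx dotvNr (lmi_form h gm P S P2 P3 P4 RT yE).
rewrite [in X in X <= _]/sqn !dotv_col -/(sqn x) -/(sqn y) -/(sqn z) -/(sqn d).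
have D : sqn d <= gm ^+ 2 * sqn x + c / 2 * sqn x + (1 + 2 * gm ^+ 2 / c) * u ^+ 2.
  apply: (@le_trans _ _ ((gm * enorm x + u) ^+ 2)).
    by rewrite -sqr_enorm lerXn2r ?nnegrE ?enorm_ge0//; apply: le_trans Hd; exact: enorm_ge0.
  rewrite -!sqr_enorm -subr_ge0.
  rewrite (_ : _ - _ = (2 * c)^-1 * (c * enorm x - 2 * gm * u) ^+ 2); last first.
    by field; rewrite gt_eqF.
  by rewrite mulr_ge0 ?sqr_ge0// invr_ge0; lra.
have := sqn_ge0 y; have := sqn_ge0 z; have := sqn_ge0 d.
move: (sqn x) (sqn y) (sqn z) (sqn d) D => sx sy sz sd D sd0 sz0 sy0.
have : 0 <= c * sy by rewrite mulr_ge0// ltW.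
have : 0 <= c * sz by rewrite mulr_ge0// ltW.
have : 0 <= c * sd by rewrite mulr_ge0// ltW.
lra.
Qed.

(** On the first delay interval the delayed term is the initial function, so [|x|^2] satisfies
a linear differential inequality and Gronwall's inequality applies. *)
Lemma first_delay_interval n (h gm : F) (A A1 : 'M[F]_n) : 0 <= h ->
  exists2 C, 0 <= C & forall (x x' : F -> 'cV[F]_n) (H u b : F),
    (forall i (t : F), is_derive t 1 (fun s => x s i 0) (x' t i 0)) ->
    (forall t, - h <= t <= 0 -> sqn (x t) <= H ^+ 2) ->
    (forall t, 0 <= t <= b ->
       enorm (x' t - A *m x t - A1 *m x (t - h)) <= gm * enorm (x t) + u) ->
    forall t, 0 <= t <= b -> t <= h ->
      sqn (x t) + sqn (x' t) <= C * (H ^+ 2 + u ^+ 2).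
Proof.
move=> h0; have [C C0 HC] := rhs_bound A A1 gm.
pose E := expR ((1 + C) * h).
exists ((1 + C) * (2 * E) + C) => [|x x' H u b xd xH xeq t /andP[t0 tb] th].
  by rewrite addr_ge0// !mulr_ge0 ?expR_ge0//; lra.
have HC' s : 0 <= s <= t -> sqn (x' s) <= C * (sqn (x s) + (H ^+ 2 + u ^+ 2)).
  move=> /andP[s0 st]; rewrite addrA; apply: le_trans.
    by apply: (HC _ _ (x (s - h)) u); apply: xeq; lra.
  by rewrite ler_wpM2l// lerD2r lerD2l xH//; lra.
have xt : sqn (x t) <= 2 * E * (H ^+ 2 + u ^+ 2).
  (* adding the constant source makes the inequality homogeneous *)
  pose f s := sqn (x s) + (H ^+ 2 + u ^+ 2).
  have := @gronwall _ f (fun s => dotv (x' s) (x s) + dotv (x s) (x' s) + 0) (1 + C) 0 t t0.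
  have fd (s : F) : 0 <= s <= t -> is_derive s 1 f (dotv (x' s) (x s) + dotv (x s) (x' s) + 0).
    by move=> _; apply: is_derive_add; apply: is_derive_dotv.
  move=> /(_ fd) Gr.
  have {Gr} : f t <= expR ((1 + C) * (t - 0)) * f 0.
    apply: Gr => s st; rewrite addr0 (dotvC (x' s)) -mulr2n -mulr_natl.
    rewrite (le_trans (dotv_le _ _))// /f.
    have := HC' _ st; have := sqr_ge0 H; have := sqr_ge0 u; lra.
  have x0 : sqn (x 0) <= H ^+ 2 by apply: xH; lra.
  have : expR ((1 + C) * (t - 0)) * f 0 <= E * f 0.
    rewrite ler_wpM2r//; first by rewrite addr_ge0 ?addr_ge0 ?sqr_ge0 ?sqn_ge0.
    by rewrite ler_expR ler_wpM2l//; lra.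
  have : E * f 0 <= E * (2 * (H ^+ 2 + u ^+ 2)).
    by rewrite ler_wpM2l ?expR_ge0// /f; have := sqr_ge0 u; lra.
  have xf : sqn (x t) <= f t by rewrite /f; have := sqr_ge0 H; have := sqr_ge0 u; lra.
  by move=> a1 a2 a3; rewrite (le_trans xf) ?(le_trans a3) ?(le_trans a2)// (le_trans a1)// -mulrA mulrCA.
have tt : 0 <= t <= t by rewrite t0 lexx.
have := HC' _ tt.
have : (1 + C) * sqn (x t) <= (1 + C) * (2 * E * (H ^+ 2 + u ^+ 2)).
  by rewrite ler_wpM2l//; lra.
lra.
Qed.
End SmoothSystem.

(** * Window integrals *)

Section LyapunovKrasovskii.
Context {F : realType}.

(** The middle term is the integral of [(s - t + h) * p s] over the window [[t - h, t]],
integrated by parts; its weight lies between 0 and [h].  Writing it with the iterated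
antiderivatives [D] and [DD] of [p] makes its derivative immediate. *)
Lemma triangular_window_bounds (h t : F) (D p DD : F -> F) : 0 <= h ->
  (forall s : F, is_derive s 1 D (p s)) ->
  (forall s : F, is_derive s 1 DD (D s)) ->
  (forall s, 0 <= p s) ->
  0 <= h * D t - (DD t - DD (t - h)) <= h * (D t - D (t - h)).
Proof.
move=> h0 Dd DDd p0.
have th : t - h <= t by lra.
have mon a b : a <= b -> D a <= D b.
  move=> ab; rewrite -subr_ge0 -[leLHS](subrr (0 : F)).
  by apply: (@increment_le _ (fun=> 0) (fun=> 0) D p) => // s _.
have up : DD t - DD (t - h) <= D t * t - D t * (t - h).
  apply: (@increment_le _ DD D (fun s => D t * s) (fun=> D t)) => // [s _|s /andP[_ st]].
    exact: is_derive_linear.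
  exact: mon.
have dn : D (t - h) * t - D (t - h) * (t - h) <= DD t - DD (t - h).
  apply: (@increment_le _ (fun s => D (t - h) * s) (fun=> D (t - h)) DD D) => // [s _|s /andP[st _]].
    exact: is_derive_linear.
  exact: mon.
lra.
Qed.

(** Jensen's inequality for the convex function [v |-> v^T R v], which lies above its tangent at
the mean [w / h] of [x'] over the window. *)
Lemma jensen_window n (h t : F) (R : 'M[F]_n) (x x' : F -> 'cV[F]_n) (Q : F -> F) :
  posdef R -> 0 <= h ->
  (forall i (s : F), is_derive s 1 (fun s => x s i 0) (x' s i 0)) ->
  (forall s : F, is_derive s 1 Q (dotv (x' s) (R *m x' s))) ->
  dotv (x t - x (t - h)) (R *m (x t - x (t - h))) <= h * (Q t - Q (t - h)).
Proof.
move=> Rpos h0 xd Qd; have [RT _] := Rpos.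
have [c c0 Hc] := posdef_coercive Rpos.
have R0 v : 0 <= dotv v (R *m v).
  by apply: le_trans (Hc v); rewrite mulr_ge0 ?sqn_ge0 ?ltW.
have [w wE] : exists w, w = x t - x (t - h) by eexists.
rewrite -wE.
have [hE|hN] := eqVneq h 0.
  by rewrite wE hE subr0 subrr dotv0l mul0r.
have hp : 0 < h by rewrite lt_def hN.
pose q := dotv w (R *m w).
pose f s := 2 * dotv w (R *m x s) - h^-1 * q * s.
have := @increment_le _ f (fun s => 2 * (dotv 0 (R *m x s) + dotv w (R *m x' s)) - h^-1 * q)
  (fun s => h * Q s) (fun s => h * dotv (x' s) (R *m x' s)) (t - h) t.
have th : t - h <= t by lra.
move=> /(_ th) I.
have {I} : f t - f (t - h) <= h * Q t - h * Q (t - h).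
  apply: I => s _.
  - apply: is_derive_sub; last exact: is_derive_linear.
    apply: is_derive_scale.
    apply: (@is_derive_dotv _ n (fun=> w) (fun s => R *m x s)) => i; last exact: is_derive_mulmx.
    have -> : (0 : 'cV[F]_n) i 0 = 0 by rewrite mxE.
    exact: is_derive_const.
  - have := R0 (h *: x' s - w); rewrite mulmxBr dotvDr dotvNr !dotvDl !dotvNl.
    have -> : dotv (h *: x' s) (R *m w) = h * dotv w (R *m x' s).
      by rewrite dotvZl dotvM RT dotvC.
    rewrite -scalemxAr !dotvZr dotvZl dotv0l -/q => H.
    rewrite -subr_ge0 -(pmulr_rge0 _ hp).
    rewrite [leRHS](_ : _ = h * (h * dotv (x' s) (R *m x' s)) -
      h * dotv w (R *m x' s) - (h * dotv w (R *m x' s) - q)); last by field.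
    by lra.
have -> : f t - f (t - h) = q.
  rewrite /f (_ : _ - _ = 2 * (dotv w (R *m x t) - dotv w (R *m x (t - h))) - q); last by field.
  by rewrite -dotvNr -dotvDr -mulmxBr -wE -/q; ring.
by rewrite -mulrBr.
Qed.
End LyapunovKrasovskii.

(** * Exponential decay of smooth curves *)

Section Decay.
Context {F : realType}.

(** The window integrals of the functional are not controlled by the pointwise dissipation
[- c * g].  The additional weight [kap] produces the dissipation [- kap * I], where
[I] is the integral of [g] over the window; since [Cv * (g + I)] dominates the functional, this
is decay at rate [kap / Cv]. *)
Lemma krasovskii_decay n (h gm : F) (A A1 P R S P2 P3 P4 : 'M[F]_n) :
  0 <= h -> posdef P -> posdef R -> posdef S ->
  negdef (lmi_matrix h gm A A1 P R S P2 P3 P4) ->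
  exists lam C : F, [/\ 0 < lam, 0 <= C &
    forall (x x' : F -> 'cV[F]_n) (u b B : F),
      (forall i (t : F), is_derive t 1 (fun s => x s i 0) (x' t i 0)) ->
      (forall i, continuous (fun t => x' t i 0)) ->
      0 <= u ->
      (forall t, h <= t <= b ->
         enorm (x' t - A *m x t - A1 *m x (t - h)) <= gm * enorm (x t) + u) ->
      (forall t, 0 <= t <= h -> sqn (x t) + sqn (x' t) <= B) ->
      forall t, h <= t <= b ->
        sqn (x t) <= C * (expR (- lam * (t - h)) * B + u ^+ 2)].
Proof.
move=> h0 Ppos Rpos Spos Wneg.
have [cP cP0 HcP] := posdef_coercive Ppos.
have [cR cR0 HcR] := posdef_coercive Rpos.
have [cS cS0 HcS] := posdef_coercive Spos.
have [CP CP0 HCP] := dotv_mulmx_le P.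
have [CR CR0 HCR] := dotv_mulmx_le R.
have [CS CS0 HCS] := dotv_mulmx_le S.
have [c [K [c0 K0 HW]]] := lmi_dissipation Rpos Wneg.
(* the weight of the extra window term: its production h * kap * g is absorbed by c * g,
   and it returns the dissipation kap of the window integral of g *)
have [kap kap0 kaph] : exists2 kap, 0 < kap & kap * (h + 1) = c / 2.
  by exists (c / 2 / (h + 1)); [rewrite !divr_gt0//; lra | field; apply: lt0r_neq0; lra].
pose C1 := h * CR + kap.
have C10 : 0 <= C1 by rewrite addr_ge0 ?mulr_ge0// ltW.
pose Cv := CP + CS + h * C1 + 1.
have hC10 : 0 <= h * C1 by rewrite mulr_ge0.
have Cv1 : 1 <= Cv by rewrite /Cv; lra.
have [lam lam0 lamC] : exists2 lam, 0 < lam & lam * Cv = kap.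
  have Cv0 : 0 < Cv by lra.
  by exists (kap / Cv); [rewrite divr_gt0 | rewrite divfK ?gt_eqF].
exists lam, (((1 + h) * Cv + K / lam) / cP); split=> //.
  apply: divr_ge0; last exact: ltW.
  by rewrite addr_ge0 ?mulr_ge0 ?invr_ge0//; lra.
move=> x x' u b B xd x'c u0 xeq xB t /andP[ht tb].
have xc i : continuous (fun s => x s i 0) by move=> s; exact: is_derive_continuous.
pose g s := sqn (x s) + sqn (x' s).
pose r s := dotv (x s) (S *m x s).
pose q s := dotv (x' s) (R *m x' s).
have cg : continuous g.
  by move=> s; apply: cvgD; [exact: (continuous_dotv xc xc) | exact: (continuous_dotv x'c x'c)].
have cr : continuous r by apply: continuous_dotv => //; exact: continuous_mulmx.
have cq : continuous q by apply: continuous_dotv => //; exact: continuous_mulmx.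
have [G Gd] := antiderivative cg.
have [Rr Rd] := antiderivative cr.
have [Q Qd] := antiderivative cq.
pose p s := h * q s + kap * g s.
pose D s := h * Q s + kap * G s.
have Dd (s : F) : is_derive s 1 D (p s).
  by apply: is_derive_add; exact: is_derive_scale.
have cD : continuous D by move=> s; exact: is_derive_continuous.
have [DD DDd] := antiderivative cD.
have g0 s : 0 <= g s by rewrite addr_ge0 ?sqn_ge0.
have xg s : sqn (x s) <= g s by rewrite lerDl sqn_ge0.
have x'g s : sqn (x' s) <= g s by rewrite lerDr sqn_ge0.
have q0 s : 0 <= q s by apply: le_trans (HcR _); rewrite mulr_ge0 ?sqn_ge0 ?ltW.
have r0 s : 0 <= r s by apply: le_trans (HcS _); rewrite mulr_ge0 ?sqn_ge0 ?ltW.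
have p0 s : 0 <= p s := addr_ge0 (mulr_ge0 h0 (q0 s)) (mulr_ge0 (ltW kap0) (g0 s)).
have rg s : r s <= CS * g s by apply: le_trans (HCS _) _; rewrite ler_wpM2l.
have qg s : q s <= CR * g s by apply: le_trans (HCR _) _; rewrite ler_wpM2l.
have pg s : p s <= C1 * g s.
  by rewrite /C1 mulrDl lerD2r -mulrA ler_wpM2l.
have hle s : s - h <= s by lra.
pose I s := G s - G (s - h).
have I0 s : 0 <= I s.
  rewrite /I -[leLHS](subrr (0 : F)).
  by apply: (@increment_le _ (fun=> 0) (fun=> 0) G g).
have RI s : 0 <= Rr s - Rr (s - h) <= CS * I s.
  apply/andP; split.
    by rewrite -[leLHS](subrr (0 : F)); apply: (@increment_le _ (fun=> 0) (fun=> 0) Rr r).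
  rewrite /I mulrBr.
  by apply: (@increment_le _ Rr r (fun s => CS * G s) (fun s => CS * g s)).
have DI s : D s - D (s - h) <= C1 * I s.
  rewrite /I mulrBr.
  by apply: (@increment_le _ D p (fun s => C1 * G s) (fun s => C1 * g s)).
pose V s := dotv (x s) (P *m x s) + (Rr s - Rr (s - h)) + (h * D s - (DD s - DD (s - h))).
have Vlo s : cP * sqn (x s) <= V s.
  have := HcP (x s); have /andP[+ _] := RI s.
  have /andP[+ _] := @triangular_window_bounds _ h s D p DD h0 Dd DDd p0.
  by rewrite /V; lra.
have Vup s : V s <= Cv * (g s + I s).
  have /andP[_ H1] := RI s.
  have /andP[_ H2] := @triangular_window_bounds _ h s D p DD h0 Dd DDd p0.
  have H3 : h * (D s - D (s - h)) <= h * (C1 * I s) by rewrite ler_wpM2l.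
  have H4 : CP * sqn (x s) <= CP * g s by rewrite ler_wpM2l.
  have H5 : 0 <= CS * g s by rewrite mulr_ge0.
  have H6 : 0 <= CP * I s by rewrite mulr_ge0.
  have H7 : 0 <= h * C1 * g s by rewrite mulr_ge0.
  by have := HCP (x s); have := g0 s; have := I0 s; rewrite /V /Cv; lra.
pose V' s := 2 * dotv (x s) (P *m x' s) + (r s - r (s - h)) + (h * p s - (D s - D (s - h))).
have sh f (a : F -> F) : (forall s : F, is_derive s 1 f (a s)) ->
    forall s : F, is_derive s 1 (fun s => f s - f (s - h)) (a s - a (s - h)).
  move=> fd s; apply: is_derive_sub => //.
  exact: (@is_derive_translate _ f (- h) s).
have [PT _] := Ppos.
have Vd (s : F) : is_derive s 1 V (V' s).
  have Pd : is_derive s 1 (fun s => dotv (x s) (P *m x s)) (2 * dotv (x s) (P *m x' s)).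
    have -> : 2 * dotv (x s) (P *m x' s) = dotv (x' s) (P *m x s) + dotv (x s) (P *m x' s).
      by rewrite (dotvM P (x' s)) PT (dotvC (P *m x' s)); ring.
    by apply: is_derive_dotv => // i; exact: is_derive_mulmx.
  exact: (is_derive_add (is_derive_add Pd (sh _ _ Rd s))
    (is_derive_sub (is_derive_scale h (Dd s)) (sh _ _ DDd s))).
have Vdiss s : h <= s <= b -> V' s <= - lam * V s + K * u ^+ 2.
  move=> sb; have := HW (x s) (x' s) (x (s - h)) u u0 (xeq _ sb).
  have := jensen_window s Rpos h0 xd Qd.
  rewrite -/(g s) -/(r s) -/(r (s - h)) -/(q s) /V' /D /p.
  rewrite (_ : _ - (_ - _) = h ^+ 2 * q s + kap * h * g s -
    h * (Q s - Q (s - h)) - kap * I s); last by rewrite /I; ring.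
  have LV : lam * V s <= kap * (g s + I s) by rewrite -lamC -mulrA ler_wpM2l// ltW.
  have kg : kap * g s <= c * g s - kap * h * g s.
    rewrite -subr_ge0 (_ : _ - _ = (c - kap * (h + 1)) * g s); last by ring.
    by rewrite kaph mulr_ge0//; lra.
  by lra.
(* the shift by the equilibrium value of the bound makes the inequality homogeneous *)
pose y s := V s - K / lam * u ^+ 2.
have := @gronwall _ y (fun s => V' s - 0) (- lam) h t ht.
have yd (s : F) : h <= s <= t -> is_derive s 1 y (V' s - 0).
  by move=> _; exact: (is_derive_sub (Vd s) (is_derive_const _ s)).
move=> /(_ yd) yle.
have {yle} Vt : y t <= expR (- lam * (t - h)) * y h.
  apply: yle => s /andP[hs st]; rewrite subr0 /y mulrBr.
  rewrite (_ : - lam * (_ * _) = - (K * u ^+ 2)); last by field; exact: lt0r_neq0.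
  by rewrite opprK; apply: Vdiss; rewrite hs (le_trans st).
have hb : 0 <= h <= h by rewrite h0 lexx.
have B0 : 0 <= B by apply: le_trans (xB _ hb); exact: g0.
have Ih : I h <= h * B.
  have -> : h * B = B * h - B * (h - h) by ring.
  apply: (@increment_le _ G g (fun s => B * s) (fun=> B)) => // [s _|s].
    exact: is_derive_linear.
  by rewrite subrr; exact: xB.
have Vh : y h <= (1 + h) * Cv * B.
  have : 0 <= K / lam * u ^+ 2 by rewrite mulr_ge0 ?sqr_ge0 ?divr_ge0// ltW.
  have : Cv * (g h + I h) <= Cv * (B + h * B).
    by rewrite ler_wpM2l//; [lra | apply: lerD => //; exact: xB].
  by have := Vup h; rewrite /y; lra.
set e := expR _ in Vt *.
have e0 : 0 <= e by exact: expR_ge0.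
have Vh' : e * y h <= e * ((1 + h) * Cv * B) by rewrite ler_wpM2l.
rewrite -[in leRHS]mulrA [_^-1 * _]mulrC mulrA ler_pdivlMr// mulrC.
apply: le_trans (Vlo t) _.
have : 0 <= K / lam * (e * B) by rewrite !mulr_ge0 ?invr_ge0// ltW.
have : 0 <= (1 + h) * Cv * u ^+ 2 by rewrite !mulr_ge0 ?sqr_ge0//; lra.
by move: Vt; rewrite {1}/y; lra.
Qed.

(** The constants [lam] and [M] do not depend on the curve, which is what makes the estimate
survive the limit of averages. *)
Definition smooth_decay n (h gm lam M : F) (A A1 : 'M[F]_n) : Prop :=
  forall (x x' : F -> 'cV[F]_n) (H u b : F),
    (forall i (t : F), is_derive t 1 (fun s => x s i 0) (x' t i 0)) ->
    (forall i, continuous (fun t => x' t i 0)) ->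
    0 <= u ->
    (forall t, - h <= t <= 0 -> sqn (x t) <= H ^+ 2) ->
    (forall t, 0 <= t <= b ->
       enorm (x' t - A *m x t - A1 *m x (t - h)) <= gm * enorm (x t) + u) ->
    forall t, 0 <= t <= b ->
      sqn (x t) <= M * (expR (- lam * t) * H ^+ 2 + u ^+ 2).

Lemma smooth_estimate n (h gm : F) (A A1 P R S P2 P3 P4 : 'M[F]_n) :
  0 <= h -> posdef P -> posdef R -> posdef S ->
  negdef (lmi_matrix h gm A A1 P R S P2 P3 P4) ->
  exists lam M : F, [/\ 0 < lam, 1 <= M & smooth_decay h gm lam M A A1].
Proof.
move=> h0 Ppos Rpos Spos Wneg.
have [lam [C [lam0 C0 HC]]] := krasovskii_decay h0 Ppos Rpos Spos Wneg.
have [C1 C10 HC1] := first_delay_interval gm A A1 h0.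
pose E := expR (lam * h).
have E1 : 1 <= E by rewrite -expR0 ler_expR mulr_ge0// ltW.
have E0 : 0 <= E by lra.
have CC : 0 <= C * C1 by rewrite mulr_ge0.
exists lam, (1 + C1 * E + C * C1 * E + C); split=> //.
  by have := mulr_ge0 C10 (le_trans ler01 E1); have := mulr_ge0 CC (le_trans ler01 E1); lra.
move=> x x' H u b xd x'c u0 xH xeq t /andP[t0 tb].
have first s : 0 <= s <= b -> s <= h -> sqn (x s) + sqn (x' s) <= C1 * (H ^+ 2 + u ^+ 2).
  exact: HC1 xd xH xeq s.
set e := expR (- lam * t).
have e0 : 0 <= e by exact: expR_ge0.
have e1 : e <= 1 by rewrite -expR0 ler_expR mulNr oppr_le0 mulr_ge0// ltW.
have H0 := sqr_ge0 H; have U0 := sqr_ge0 u.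
have eH0 : 0 <= e * H ^+ 2 by rewrite mulr_ge0.
have [th|ht] := leP t h.
  have eE : 1 <= E * e.
    by rewrite -expRD -expR0 ler_expR mulNr -mulrBr mulr_ge0//; [exact: ltW|lra].
  have := first t; rewrite t0 tb => /(_ isT th); have := sqn_ge0 (x' t).
  have : C1 * H ^+ 2 <= C1 * E * (e * H ^+ 2).
    by rewrite -mulrA ler_wpM2l// mulrA ler_peMl.
  have : C1 * u ^+ 2 <= C1 * E * u ^+ 2 by rewrite ler_wpM2r// ler_peMr.
  have : 0 <= C * C1 * E * (e * H ^+ 2 + u ^+ 2).
    by rewrite !mulr_ge0 ?addr_ge0//; lra.
  have : 0 <= (1 + C) * (e * H ^+ 2 + u ^+ 2) by rewrite mulr_ge0 ?addr_ge0//; lra.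
  lra.
have := HC x x' u b (C1 * (H ^+ 2 + u ^+ 2)) xd x'c u0.
have a1 s : h <= s <= b -> enorm (x' s - A *m x s - A1 *m x (s - h)) <= gm * enorm (x s) + u.
  by move=> sb; apply: xeq; lra.
have a2 s : 0 <= s <= h -> sqn (x s) + sqn (x' s) <= C1 * (H ^+ 2 + u ^+ 2).
  by move=> /andP[s0 sh]; apply: first => //; lra.
move=> /(_ a1 a2 t); rewrite tb ltW// => /(_ isT).
have -> : expR (- lam * (t - h)) = E * e by rewrite -expRD; congr expR; ring.
have : C * C1 * E * (e * u ^+ 2) <= C * C1 * E * u ^+ 2.
  by rewrite ler_wpM2l ?mulr_ge0//; rewrite ler_piMl.
have := mulr_ge0 (addr_ge0 ler01 (mulr_ge0 C10 E0)) (addr_ge0 eH0 U0).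
have : 0 <= C * (e * H ^+ 2) by rewrite mulr_ge0.
lra.
Qed.
End Decay.

(** * Absolutely continuous and continuous curves *)

Section AbsolutelyContinuousCurves.
Context {F : realType}.
Local Notation mu := (@lebesgue_measure F).

Lemma coord_le_norm n (v : 'cV[F]_n) i : `|v i 0| <= `|v|.
Proof.
rewrite [leRHS]/Num.Def.normr/= mx_normrE.
exact: (le_bigmax _ (fun ij : 'I_n * 'I_1 => `|v ij.1 ij.2|) (i, ord0)).
Qed.

Lemma is_derive_coord n (e : F -> 'cV[F]_n) (v : 'cV[F]_n) (t : F) i :
  is_derive t 1 e v -> is_derive t 1 (fun s => e s i 0) (v i 0).
Proof.
move=> [ed <-]; apply: DeriveDef; first by have /derivable_mxP := ed; exact.
by rewrite derive_mx// mxE.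
Qed.

Lemma abs_continuous_lipschitz n (e : F -> 'cV[F]_n) (f : F -> F) (a b C D : F) :
  0 <= C -> 0 <= D -> abs_continuous a b e ->
  (forall x y, a <= x -> x <= y -> y <= b ->
     `|f y - f x| <= C * `|e y - e x| + D * (y - x)) ->
  abs_continuous a b (f : F -> F^o).
Proof.
move=> C0 D0 ace fe eps eps0.
have e1 : 0 < eps / 2 / (C + 1) by rewrite !divr_gt0//; lra.
have e2 : 0 < eps / 2 / (D + 1) by rewrite !divr_gt0//; lra.
have [d d0 Hd] := ace _ e1.
exists (Num.min d (eps / 2 / (D + 1))); first by rewrite lt_min d0.
move=> m x y xy triv; rewrite lt_min => /andP[s1 s2].
have {Hd} s3 := Hd m x y xy triv s1.
apply: (@le_lt_trans _ _ (C * (\sum_(i < m) `|e (y i) - e (x i)|) +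
    D * \sum_(i < m) (y i - x i))).
  rewrite !mulr_sumr -big_split; apply: ler_sum => i _ /=.
  by have [? [? ?]] := xy i; exact: fe.
have S1 : 0 <= \sum_(i < m) `|e (y i) - e (x i)| by apply: sumr_ge0.
have S2 : 0 <= \sum_(i < m) (y i - x i).
  by apply: sumr_ge0 => i _; have [? [? ?]] := xy i; lra.
have C1 : 0 < C + 1 by lra.
have D1 : 0 < D + 1 by lra.
by move: s2 s3; rewrite (ltr_pdivlMr _ _ D1) (ltr_pdivlMr _ _ C1); lra.
Qed.

(** For [w] the increment of [e - phi], the scalar function
[w . (e - phi) - |w| * K * t] has nonpositive derivative almost everywhere, hence does not
increase: [|w|^2 <= |w| * K * (b - a)]. *)
Lemma ac_mean_value n (e phi psi : F -> 'cV[F]_n) (a b K : F) :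
  a <= b -> 0 <= K -> abs_continuous a b e ->
  (forall i (t : F), is_derive t 1 (fun s => phi s i 0) (psi t i 0)) ->
  (forall i, continuous (fun t => psi t i 0)) ->
  {ae mu, forall t, a < t < b -> exists2 v, is_derive t 1 e v & enorm (v - psi t) <= K} ->
  enorm ((e b - phi b) - (e a - phi a)) <= K * (b - a).
Proof.
move=> ab K0 ace phid psic aed.
have [w wE] : exists w, w = (e b - phi b) - (e a - phi a) by eexists.
rewrite -wE.
pose k t := dotv w (phi t) + enorm w * K * t.
pose dk t := dotv w (psi t) + enorm w * K.
have kd (t : F) : is_derive t 1 k (dk t).
  have wd : is_derive t 1 (fun t => dotv w (phi t)) (dotv w (psi t)).
    rewrite -[dotv w (psi t)]add0r -{1}(dotv0l (phi t)).
    apply: (@is_derive_dotv _ n (fun=> w) phi) => // i.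
    have -> : (0 : 'cV[F]_n) i 0 = 0 by rewrite mxE.
    exact: is_derive_const.
  exact: (is_derive_add wd (is_derive_linear _ t)).
have dkc : continuous (fun t => `|dk t|).
  move=> t; apply: cvg_norm; apply: cvgD; last exact: cvg_cst.
  by apply: (@continuous_dotv _ _ n (fun=> w) psi) => // i s; exact: cvg_cst.
have [c _ cmax] := EVT_max ab (continuous_subspaceT dkc).
pose f t := dotv w (e t) - k t.
have acf : abs_continuous a b (f : F -> F^o).
  apply: (@abs_continuous_lipschitz n e f a b (\sum_(i < n) `|w i 0|) `|dk c|) => //.
    exact: sumr_ge0.
  move=> x y ax xy yb.
  have -> : f y - f x = dotv w (e y - e x) - (k y - k x).
    by rewrite /f dotvDr dotvNr; ring.
  rewrite (le_trans (ler_normB _ _))// lerD//.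
    rewrite /dotv (le_trans (ler_norm_sum _ _ _))// mulr_suml ler_sum// => i _.
    by rewrite normrM ler_wpM2l// coord_le_norm.
  have [z zxy ->] := @mean_value _ k dk x y xy (fun t _ => kd t).
  rewrite normrM (ger0_norm (_ : 0 <= y - x)) ?subr_ge0// ler_wpM2r ?subr_ge0//.
  by apply: cmax; rewrite in_itv/=; lra.
have : f b <= f a.
  apply: ac_ae_nonincreasing ab acf _.
  apply: (@filterS _ _ (ae_filter_ringOfSetsType mu)) aed => t /= H tab; have [v vd vK] := H tab.
  exists (dotv w v - dk t).
    rewrite /dk opprD addrA -dotvNr -dotvDr subr_le0 (le_trans (dotv_le_enorm _ _))//.
    by rewrite ler_wpM2l// enorm_ge0.
  apply: is_derive_sub => //.
  rewrite -[dotv w v]add0r -{1}(dotv0l (e t)).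
  apply: (@is_derive_dotv _ n (fun=> w) e) => // i.
    have -> : (0 : 'cV[F]_n) i 0 = 0 by rewrite mxE.
    exact: is_derive_const.
  exact: is_derive_coord.
move=> fba.
have : enorm w ^+ 2 <= enorm w * (K * (b - a)).
  rewrite sqr_enorm /sqn {2}wE !dotvDr !dotvNr !dotvDr !dotvNr.
  by move: fba; rewrite /f /k; lra.
have := enorm_ge0 w; rewrite le_eqVlt => /predU1P[<- _|w0].
  by rewrite mulr_ge0// subr_ge0.
by rewrite expr2 ler_pM2l.
Qed.

Lemma uniform_modulus (V : normedModType F) (f : F -> V) (a b eta : F) :
  continuous f -> a <= b -> 0 < eta -> exists2 d, 0 < d & forall s t,
    a <= s <= b -> a <= t <= b -> `|s - t| < d -> `|f s - f t| <= eta.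
Proof.
move=> cf ab eta0.
pose P y := exists2 d, 0 < d & forall s t,
    a <= s <= y -> a <= t <= y -> `|s - t| < d -> `|f s - f t| <= eta.
apply: (@real_induction _ P a b ab) => [|x xab].
  exists 1 => // s t sa ta _; have -> : s = t by lra.
  by rewrite subrr normr0 ltW.
have /cvgrPdist_le/(_ _ (divr_gt0 eta0 (ltr0n F 2)))/nbhs_ballP[r /= r0 Hr] := cf x.
exists (r / 2); first by rewrite divr_gt0.
move=> y z /andP[ay yx] xry /andP[xz zb] zxr [d d0 Hd].
exists (Num.min d (r / 2)); first by rewrite lt_min d0 divr_gt0.
have near s t : y < t -> t <= z -> `|s - t| < r / 2 -> s <= z -> `|f s - f t| <= eta.
  move=> yt tz st sz.
  have H u : x - r < u -> u < x + r -> `|f x - f u| <= eta / 2.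
    by move=> u1 u2; apply: Hr; rewrite /ball/= ltr_norml; lra.
  move: st; rewrite ltr_norml => /andP[st1 st2].
  rewrite -(subrKA (f x)) (le_trans (ler_normD _ _))//.
  rewrite distrC (le_trans (lerD (H s _ _) (H t _ _)))//; lra.
move=> s t /andP[as_ sz] /andP[at_ tz]; rewrite lt_min => /andP[st1 st2].
have [sy|ys] := leP s y; last first.
  by rewrite distrC; apply: near => //; rewrite distrC.
have [ty|yt] := leP t y; last exact: near.
by apply: Hd => //; rewrite ?as_ ?at_.
Qed.

Lemma continuous_clamp (V : topologicalType) (f : F -> V) (a b : F) : a <= b ->
  {within `[a, b], continuous f} ->
  continuous (fun s => f (Num.max a (Num.min s b))).
Proof.
move=> ab /subspace_continuousP cf s.
pose c s := Num.max a (Num.min s b).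
have cab u : `[a, b]%classic (c u).
  by rewrite /= in_itv/= /c le_max lexx/= ge_max ab/= ge_min lexx orbT.
have cc : continuous c.
  move=> u; apply: (@continuous_max F F (fun=> a) (fun s => Num.min s b)).
    exact: cvg_cst.
  by apply: (@continuous_min F F id (fun=> b)); [exact: cvg_id | exact: cvg_cst].
apply: cvg_trans (cf _ (cab s)) => W /= /(cc s) H.
by apply: (@filterS _ (nbhs s) _ _ _ _ H) => u; apply; exact: cab.
Qed.

Lemma abs_continuous_within n (e : F -> 'cV[F]_n) (a b : F) :
  abs_continuous a b e -> {within `[a, b], continuous e}.
Proof.
move=> ace; apply/subspace_continuousP => x; rewrite /= in_itv/= => xab.
apply/cvgrPdist_lt => eps eps0.
have [d d0 Hd] := ace _ eps0.
have inc u v : a <= u -> u <= v -> v <= b -> v - u < d -> `|e v - e u| < eps.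
  move=> au uv vb uvd.
  have := Hd 1%N (fun=> u) (fun=> v).
  rewrite !big_ord1; apply => //.
  by apply/trivIsetP => i j _ _; rewrite (ord1 i) (ord1 j) eqxx.
have := nbhsx_ballx x d d0.
apply: filterS => y; rewrite /ball/= ltr_norml => /andP[xy1 xy2]; rewrite /= in_itv/= => yab.
have [xy|yx] := leP x y; last by apply: inc; lra.
by rewrite distrC; apply: inc; lra.
Qed.
End AbsolutelyContinuousCurves.

(** * Averaging *)

Section Mollification.
Context {F : realType}.
Local Notation mu := (@lebesgue_measure F).

(** Here [x s] is the average of [e] over [[s, s + d]], with [d] so small that [e] varies by at
most [eta] over such an interval; it differs from [e] by at most [n * eta] there.  Its derivative is
a difference quotient of [e], and [x' - A x - A1 x(. - h)] is the difference quotient of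
[e - phi], where [phi] is an antiderivative of [A e + A1 e(. - h)]; the mean value
inequality bounds it.  The average looks forward, so the estimate reaches [T - d] and
uses [e] on [[- h, T]] only. *)
Lemma steklov_estimate n (h gm lam M : F) (A A1 : 'M[F]_n) :
  0 <= h -> 0 <= gm ->
  smooth_decay h gm lam M A A1 ->
  forall (e : F -> 'cV[F]_n) (T W H eta : F), 0 < T -> 0 <= W ->
    {within `[- h, 0], continuous e} ->
    abs_continuous 0 T e ->
    (forall s, - h <= s <= 0 -> enorm (e s) <= H) ->
    {ae mu, forall t, 0 < t < T -> exists2 v, is_derive t 1 e v &
       enorm (v - A *m e t - A1 *m e (t - h)) <= gm * enorm (e t) + W} ->
    0 < eta ->
    exists (d : F) (y : 'cV[F]_n), [/\ 0 < d, d <= eta, enorm (e T) <= enorm y + n%:R * eta &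
      sqn y <= M * (expR (- lam * (T - d)) * (H + n%:R * eta) ^+ 2
                    + (gm * (n%:R * eta) + W) ^+ 2)].
Proof.
move=> h0 gm0 smooth e T W H eta T0 W0 ce0 ace eH aed eta0.
have hT : - h <= T by lra.
have ce : {within `[- h, T], continuous e}.
  have -> : `[- h, T]%classic = `[- h, 0] `|` `[0, T].
    apply/seteqP; split=> s /=; rewrite !in_itv/=.
      by move=> /andP[s1 s2]; have [s0|s0] := leP s 0; [left|right]; lra.
    by case; lra.
  apply: withinU_continuous; [exact: interval_closed|exact: interval_closed|exact: ce0|].
  exact: abs_continuous_within.
pose eb s := e (Num.max (- h) (Num.min s T)).
have ceb : continuous eb by exact: continuous_clamp ce.
have ebE s : - h <= s <= T -> eb s = e s.
  by move=> /andP[hs sT]; rewrite /eb (min_idPl sT) (max_idPr hs).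
have cebi i : continuous (fun s => eb s i 0).
  move=> s; apply: (@continuous_comp _ _ _ eb (fun v : 'cV[F]_n => v i 0)).
    exact: ceb.
  exact: coord_continuous.
have [G Gd] := choice (fun i => antiderivative (cebi i)).
pose E s : 'cV[F]_n := \col_i G i s.
have Ed i (s : F) : is_derive s 1 (fun s => E s i 0) (eb s i 0).
  by under eq_fun do rewrite mxE; exact: Gd.
have hT1 : - h <= T + 1 by lra.
have [d0 d00 Hd0] := uniform_modulus ceb hT1 eta0.
pose d := Num.min (d0 / 2) (Num.min eta (Num.min T 1)).
have dp : 0 < d by rewrite !lt_min eta0 T0 divr_gt0/=.
have dd0 : d < d0 by rewrite (@le_lt_trans _ _ (d0 / 2)) ?ge_min ?lexx//; lra.
have deta : d <= eta by rewrite !ge_min lexx orbT.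
have dT : d <= T by rewrite !ge_min lexx !orbT.
have d1 : d <= 1 by rewrite !ge_min lexx !orbT.
clearbody d.
pose x s := d^-1 *: (E (s + d) - E s).
pose x' s := d^-1 *: (eb (s + d) - eb s).
have xd i (s : F) : is_derive s 1 (fun s => x s i 0) (x' s i 0).
  have -> : (fun s => x s i 0) = (fun s => d^-1 * (E (s + d) i 0 - E s i 0)).
    by apply/funext => r; rewrite /x !mxE.
  have -> : x' s i 0 = d^-1 * (eb (s + d) i 0 - eb s i 0) by rewrite !mxE.
  apply: is_derive_scale; apply: is_derive_sub (Ed i s).
  exact: (@is_derive_translate _ (fun s => E s i 0) d s).
have x'c i : continuous (fun s => x' s i 0).
  have -> : (fun s => x' s i 0) = (fun s => d^-1 * (eb (s + d) i 0 - eb s i 0)).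
    by apply/funext => r; rewrite /x' !mxE.
  move=> s; apply: cvgM; first exact: cvg_cst.
  apply: cvgB; last exact: cebi.
  apply: (@continuous_comp _ _ _ (fun s => s + d) (fun s => eb s i 0)); last exact: cebi.
  by apply: cvgD; [exact: cvg_id | exact: cvg_cst].
have xe s r : - h <= s <= T -> s <= r <= s + d -> enorm (x s - eb r) <= n%:R * eta.
  move=> /andP[hs sT] /andP[sr rd]; apply: enorm_le_coord => [|i]; first exact: ltW.
  have sd : s <= s + d by lra.
  have [c /andP[sc cd] Ec] := @mean_value _ (fun s => E s i 0) (fun s => eb s i 0) s (s + d) sd
    (fun t _ => Ed i t).
  have -> : (x s - eb r) i 0 = (eb c - eb r) i 0.
    have -> : (x s - eb r) i 0 = d^-1 * (E (s + d) i 0 - E s i 0) - eb r i 0 by rewrite !mxE.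
    by rewrite Ec !mxE; field; exact: lt0r_neq0.
  apply: le_trans (coord_le_norm _ _) _; apply: Hd0; [lra|lra|].
  by rewrite ltr_norml; lra.
have neta0 : 0 <= n%:R * eta by rewrite mulr_ge0 ?ler0n ?ltW.
exists d, (x (T - d)); split=> //.
  have -> : e T = eb T by rewrite ebE ?hT ?lexx.
  rewrite -[eb T](subKr (x (T - d))) addrC (le_trans (ler_enormD _ _))//.
  rewrite addrC lerD2l.
  have -> : enorm (- (x (T - d) - eb T)) = enorm (x (T - d) - eb T) by rewrite !enormE sqnN.
  by apply: xe; lra.
apply: (smooth x x' _ _ (T - d)) => //.
- exact: addr_ge0 (mulr_ge0 gm0 neta0) W0.
- move=> s s0; rewrite -sqr_enorm lerXn2r ?nnegrE ?enorm_ge0//.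
    by rewrite addr_ge0// (le_trans (enorm_ge0 _) (eH _ s0)).
  rewrite -(subrK (eb s) (x s)) (le_trans (ler_enormD _ _))// addrC lerD//.
    by rewrite ebE ?eH//; lra.
  by apply: xe; lra.
- move=> s /andP[s0 sTd].
  pose phi r := A *m E r + A1 *m E (r - h).
  pose psi r := A *m eb r + A1 *m eb (r - h).
  have phid i (r : F) : is_derive r 1 (fun r => phi r i 0) (psi r i 0).
    have -> : (fun r => phi r i 0) = (fun r => (A *m E r) i 0 + (A1 *m E (r - h)) i 0).
      by apply/funext => q; rewrite /phi mxE.
    have -> : psi r i 0 = (A *m eb r) i 0 + (A1 *m eb (r - h)) i 0 by rewrite /psi mxE.
    apply: is_derive_add; apply: is_derive_mulmx => // j.
    exact: (@is_derive_translate _ (fun s => E s j 0) (- h) r).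
  have psic i : continuous (fun r => psi r i 0).
    have -> : (fun r => psi r i 0) = (fun r => (A *m eb r) i 0 + (A1 *m eb (r - h)) i 0).
      by apply/funext => q; rewrite /psi mxE.
    move=> r; apply: cvgD; first exact: (@continuous_mulmx F _ _ _ A eb cebi i r).
    apply: (@continuous_mulmx _ _ _ _ A1 (fun r => eb (r - h))) => j q.
    apply: (@continuous_comp _ _ _ (fun s => s - h) (fun s => eb s j 0)); last exact: cebi.
    by apply: cvgB; [exact: cvg_id | exact: cvg_cst].
  have ssd : s <= s + d by lra.
  pose K := gm * (enorm (x s) + n%:R * eta) + W.
  have K0 : 0 <= K by rewrite addr_ge0 ?mulr_ge0 ?addr_ge0 ?enorm_ge0.
  have acs : abs_continuous s (s + d) e.
    move=> eps eps0; have [dl dl0 Hdl] := ace _ eps0; exists dl => // m p q pq.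
    by apply: Hdl => i; have [? [? ?]] := pq i; do !split=> //; lra.
  have := @ac_mean_value _ _ e phi psi s (s + d) K ssd K0 acs phid psic.
  have : {ae mu, forall t, s < t < s + d ->
      exists2 v, is_derive t 1 e v & enorm (v - psi t) <= K}.
    apply: (@filterS _ _ (ae_filter_ringOfSetsType mu)) aed => t /= Ht tsd.
    have tT : 0 < t < T by lra.
    have [v vd vle] := Ht tT; exists v => //.
    have et : enorm (e t) <= enorm (x s) + n%:R * eta.
      have -> : e t = eb t by rewrite ebE//; lra.
      rewrite -[eb t](subKr (x s)) (le_trans (ler_enormD _ _))// lerD2l.
      rewrite enormE sqnN -enormE; apply: xe; lra.
    rewrite /psi !ebE; [|lra|lra].
    by rewrite opprD addrA (le_trans vle)// lerD2r ler_wpM2l.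
  move=> H1 /(_ H1).
  have -> : e (s + d) - phi (s + d) - (e s - phi s) =
      d *: (x' s - A *m x s - A1 *m x (s - h)).
    have dn0 : d != 0 by exact: lt0r_neq0.
    rewrite /x' /x !ebE; [|lra|lra].
    rewrite -!scalemxAr !scalerBr !scalerA mulfV// !scale1r /phi !mulmxBr.
    rewrite (_ : s - h + d = s + d - h); last by ring.
    rewrite !opprD !opprK.
    apply/matrixP => i j; rewrite !mxE. ring.
  rewrite enormE sqnZ sqrtrM ?sqr_ge0// sqrtr_sqr -enormE gtr0_norm//.
  rewrite (_ : s + d - s = d); last by ring.
  rewrite (mulrC K) ler_pM2l// => /le_trans; apply.
  by rewrite /K mulrDr addrA.
- by rewrite subr_ge0 dT lexx.
Qed.
End Mollification.

Section Inclusion.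
Context {F : realType}.
Local Notation mu := (@lebesgue_measure F).

(** The limit of [steklov_estimate] as [eta], hence also [d], tends to 0. *)
Lemma delay_inclusion_estimate n (h gm lam M : F) (A A1 : 'M[F]_n) :
  0 <= h -> 0 <= gm -> 0 <= lam -> 0 <= M -> smooth_decay h gm lam M A A1 ->
  forall (e : F -> 'cV[F]_n) (T W H : F), 0 < T -> 0 <= W ->
    {within `[- h, 0], continuous e} ->
    abs_continuous 0 T e ->
    (forall s, - h <= s <= 0 -> enorm (e s) <= H) ->
    {ae mu, forall t, 0 < t < T -> exists2 v, is_derive t 1 e v &
       enorm (v - A *m e t - A1 *m e (t - h)) <= gm * enorm (e t) + W} ->
    enorm (e T) <= Num.sqrt M * (expR (- (lam / 2) * T) * H + W).
Proof.
move=> h0 gm0 lam0 M0 smooth e T W H T0 W0 ce ace eH aed.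
have H0 : 0 <= H by apply: le_trans (enorm_ge0 _) (eH 0 _); rewrite oppr_le0 h0 lexx.
pose b r : F := Num.sqrt M * (expR (- (lam / 2) * (T - r)) * (H + n%:R * r) +
  (gm * (n%:R * r) + W)) + n%:R * r.
have eb r : 0 < r -> enorm (e T) <= b r.
  move=> r0; have [d [y [d0 dr ey yM]]] :=
    steklov_estimate h0 gm0 smooth T0 W0 ce ace eH aed r0.
  rewrite (le_trans ey)// /b lerD2r.
  have nr0 : 0 <= n%:R * r by rewrite mulr_ge0 ?ler0n ?ltW.
  set E := expR _; have E0 : 0 <= E by exact: expR_ge0.
  have a0 : 0 <= E * (H + n%:R * r) by rewrite mulr_ge0 ?addr_ge0.
  have b0 : 0 <= gm * (n%:R * r) + W by rewrite addr_ge0// mulr_ge0.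
  rewrite -(@ler_pXn2r _ 2)// ?nnegrE ?enorm_ge0 ?(mulr_ge0 (sqrtr_ge0 _) (addr_ge0 a0 b0))//.
  rewrite sqr_enorm exprMn sqr_sqrtr// (le_trans yM)// ler_wpM2l//.
  apply: (@le_trans _ _ ((E * (H + n%:R * r)) ^+ 2 + (gm * (n%:R * r) + W) ^+ 2)); last first.
    by rewrite (sqrrD (E * _)) lerD2r lerDl mulrn_wge0// mulr_ge0.
  rewrite lerD2r.
  rewrite exprMn ler_wpM2r ?sqr_ge0// /E expr2 -expRD ler_expR.
  have : lam * d <= lam * r by rewrite ler_wpM2l.
  by lra.
have cb : b r @[r --> 0^'+] --> b 0.
  apply: cvg_at_right_filter; have cn : {for 0, continuous (fun r : F => n%:R * r)}.
    exact: is_derive_continuous (is_derive_linear _ _).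
  apply: cvgD; last exact: cn.
  apply: cvgM; first exact: cvg_cst.
  apply: cvgD; last by apply: cvgD; [apply: cvgM; [exact: cvg_cst | exact: cn] | exact: cvg_cst].
  apply: cvgM; last by apply: cvgD; [exact: cvg_cst | exact: cn].
  apply: (@continuous_comp _ _ _ (fun r => - (lam / 2) * (T - r)) expR).
    by apply: cvgM; [exact: cvg_cst | apply: cvgB; [exact: cvg_cst | exact: cvg_id]].
  exact: continuous_expR.
have b0E : b 0 = Num.sqrt M * (expR (- (lam / 2) * T) * H + W).
  by rewrite /b !mulr0 !addr0 subr0 add0r.
rewrite -b0E; apply: (cvgr_to_ge cb).
by near=> r; apply: eb.
Unshelve. all: by end_near. Qed.
End Inclusion.

(** * Comparison functions, signals and closed loops *)

Section ClassK.
Context {F : realType}.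

Lemma classK_linear (c : F) : 0 < c -> classK (fun x => c * x).
Proof.
move=> c0; split; last by rewrite mulr0.
- apply: continuous_subspaceT => x.
  exact: is_derive_continuous (is_derive_linear c x).
- by move=> x y _ xy; rewrite ltr_pM2l.
Qed.

Lemma classKinf_linear (c : F) : 0 < c -> classKinf (fun x => c * x).
Proof.
move=> c0; split; first exact: classK_linear.
by apply: gt0_cvgMry => //; exact: cvg_id.
Qed.

Lemma classKL_exp (a c : F) : 0 < a -> 0 < c ->
  classKL (fun x t => c * (expR (- a * t) * x)).
Proof.
move=> a0 c0; have E t : (fun x => c * (expR (- a * t) * x)) = fun x => c * expR (- a * t) * x.
  by apply/funext => x; rewrite mulrA.
have ce : continuous (fun t => expR (- a * t)).
  move=> t; apply: (@continuous_comp _ _ _ (fun t => - a * t) expR).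
    exact: is_derive_continuous (is_derive_linear _ t).
  exact: continuous_expR.
split=> [t t0|x x0]; first by rewrite E; apply: classK_linear; rewrite mulr_gt0// expR_gt0.
split.
- apply: continuous_subspaceT => t; apply: cvgM; first exact: cvg_cst.
  by apply: cvgM; [exact: ce | exact: cvg_cst].
- move=> s t s0 st; rewrite ler_wpM2l ?(ltW c0)// ler_wpM2r// ler_expR.
  by rewrite !mulNr lerN2 ler_wpM2l// ltW.
- have -> : 0 = c * (0 * x) by rewrite mul0r mulr0.
  apply: cvgM; first exact: cvg_cst.
  apply: cvgM; last exact: cvg_cst.
  have -> : (fun t => expR (- a * t)) = (fun t => expR (- t)) \o (fun t => a * t).
    by apply/funext => t /=; rewrite mulNr.
  apply: cvg_comp; last exact: cvgr_expR.
  by apply: gt0_cvgMry => //; exact: cvg_id.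
Qed.
End ClassK.

Section Signals.
Context {F : realType}.
Local Notation mu := (@lebesgue_measure F).

Lemma enorm_le_hist_norm n (h : F) (phi : F -> 'cV[F]_n) (s : F) : 0 <= h ->
  {within `[- h, 0], continuous phi} -> - h <= s <= 0 ->
  enorm (phi s) <= hist_norm h phi.
Proof.
move=> h0 cphi s0; apply: ub_le_sup; last by exists s => //=; rewrite in_itv.
have cn : {within `[- h, 0], continuous (fun s => `|phi s|)}.
  by move=> x; apply: cvg_norm; exact: cphi.
have hle : - h <= 0 by rewrite oppr_le0.
have [c _ cmax] := EVT_max hle cn.
exists (n%:R * `|phi c|) => _ [r /= rh <-].
apply: enorm_le_coord => // i; apply: le_trans (coord_le_norm _ _) _; exact: cmax.
Qed.

Lemma hist_norm_ge0 n (h : F) (phi : F -> 'cV[F]_n) : 0 <= h ->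
  {within `[- h, 0], continuous phi} -> 0 <= hist_norm h phi.
Proof.
move=> h0 cphi; apply: le_trans (enorm_ge0 (phi 0)) _.
by apply: enorm_le_hist_norm; rewrite ?oppr_le0 ?h0 ?lexx.
Qed.

Lemma segmentE n (h : F) (e : F -> 'cV[F]_n) (t s : F) :
  - h <= s <= 0 -> segment h e t s = e (t + s).
Proof. by move=> s0; rewrite /segment /patch ifT// inE/= in_itv. Qed.

Lemma ess_norm_ge0 n (w : F -> 'cV[F]_n) : (0 <= ess_norm w)%E.
Proof.
apply: ess_sup_gee.
  apply: (@lt_le_trans _ _ (mu `[0, 1])).
    by rewrite lebesgue_measure_itv/= lte_fin ltr01 sube0 lte_fin ltr01.
  by apply: le_measure; rewrite ?inE.
apply: nearW => t; rewrite lee_fin; case: ifP => // _; exact: enorm_ge0.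
Qed.

Lemma ess_norm_ae n (w : F -> 'cV[F]_n) : (ess_norm w < +oo)%E ->
  {ae mu, forall t, 0 <= t -> enorm (w t) <= fine (ess_norm w)}.
Proof.
move=> woo; have wfin : ess_norm w \is a fin_num by rewrite ge0_fin_numE// ess_norm_ge0.
have := ess_sup_ge mu (fun t => (if 0 <= t then enorm (w t) else 0)%:E).
apply: (@filterS _ _ (ae_filter_ringOfSetsType mu)) => t /= wt t0.
by rewrite -lee_fin fineK//; move: wt; rewrite t0.
Qed.
End Signals.

Lemma closed_loop_estimate (F : realType) n (h gm lam M : F) (A A1 : 'M[F]_n)
    (kappa : 'cV[F]_n -> F -> 'cV[F]_n) :
  0 <= h -> 0 <= gm -> 0 <= lam -> 1 <= M -> smooth_decay h gm lam M A A1 ->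
  (forall xi t, enorm (kappa xi t) <= gm * enorm xi) ->
  forall (e0 w : F -> 'cV[F]_n), {within `[- h, 0], continuous e0} ->
    (ess_norm w < +oo)%E ->
  forall (T : \bar F) (e : F -> 'cV[F]_n),
    is_solution h (closed_loop (linear_delay_system h A A1) kappa) e0 w T e ->
  forall t, 0 <= t -> (t%:E < T)%E ->
    enorm (e t) <= Num.sqrt M * (expR (- (lam / 2) * t) * hist_norm h e0)
      + Num.sqrt M * fine (ess_norm w).
Proof.
move=> h0 gm0 lam0 M1 smooth kle e0 w ce0 woo T e [init ace sol] t t0 tT.
have W0 : 0 <= fine (ess_norm w) by rewrite fine_ge0// ess_norm_ge0.
have H0 := hist_norm_ge0 h0 ce0.
have eH s : - h <= s <= 0 -> enorm (e s) <= hist_norm h e0.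
  by move=> s0; rewrite init//; exact: enorm_le_hist_norm.
have [t00|tN0] := eqVneq t 0.
  rewrite t00 mulr0 expR0 mul1r (le_trans (eH 0 _))//; first by rewrite oppr_le0 h0 lexx.
  have sM : 1 <= Num.sqrt M by rewrite -sqrtr1 ler_wsqrtr.
  have : 0 <= Num.sqrt M * fine (ess_norm w) by rewrite mulr_ge0// sqrtr_ge0.
  have : 0 <= (Num.sqrt M - 1) * hist_norm h e0 by rewrite mulr_ge0// subr_ge0.
  lra.
rewrite -mulrDr; apply: (delay_inclusion_estimate h0 gm0 lam0 _ smooth) => //.
- lra.
- by rewrite lt_def tN0.
- apply: subspace_eq_continuous ce0 => s; rewrite inE/= in_itv/= => s0.
  exact: esym (init s s0).
- exact: ace.
- have := ess_norm_ae woo.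
  apply: (@filterS2 _ _ (ae_filter_ringOfSetsType _)) sol => s /= sol ws /andP[s0 st].
  have sT : (s%:E < T)%E by apply: lt_trans tT; rewrite lte_fin.
  exists (A *m e s + A1 *m e (s - h) + (kappa (e s) s + w s)).
    have := sol s0 sT; rewrite /closed_loop /linear_delay_system.
    by rewrite !segmentE ?lexx ?oppr_le0 ?h0 ?addr0.
  rewrite [X in enorm X](_ : _ = kappa (e s) s + w s); last first.
    by apply/matrixP => i j; rewrite !mxE; ring.
  rewrite (le_trans (ler_enormD _ _))// lerD//.
  exact: ws (ltW s0).
Qed.
Theorem proposition2 (F : realType) (n : nat) (h gm : F) (A A1 : 'M[F]_n)
    (h_ge0 : 0 <= h) (gm_gt0 : 0 < gm) :
  (exists P R S P2 P3 P4 : 'M[F]_n,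
     [/\ posdef P, posdef R, posdef S
       & negdef (lmi_matrix h gm A A1 P R S P2 P3 P4)]) ->
  ISS h (linear_delay_system h A A1) /\
  gain_margin h (linear_delay_system h A A1) (fun theta => gm * theta).

Proof.
move=> [P [R [S [P2 [P3 [P4 [Ppos Rpos Spos Wneg]]]]]]].
have [lam [M [lam0 M1 smooth]]] := smooth_estimate h_ge0 Ppos Rpos Spos Wneg.
have robust (kappa : 'cV[F]_n -> F -> 'cV[F]_n) :
    (forall xi t, enorm (kappa xi t) <= gm * enorm xi) ->
    ISS h (closed_loop (linear_delay_system h A A1) kappa).
  move=> kle.
  have sM0 : 0 < Num.sqrt M by rewrite sqrtr_gt0; lra.
  exists (fun x t => Num.sqrt M * (expR (- (lam / 2) * t) * x)),
    (fun x => Num.sqrt M * x); split.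
  - by apply: classKL_exp => //; lra.
  - exact: classK_linear.
  - move=> e0 w ce0 _ woo T e sol t t0 tT.
    by apply: (closed_loop_estimate h_ge0 (ltW gm_gt0) (ltW lam0) M1 smooth kle ce0 woo sol).
split; last by split=> //; exact: classKinf_linear.
(* the uncontrolled system is the closed loop with zero feedback *)
have -> : linear_delay_system h A A1 =
    closed_loop (linear_delay_system h A A1) (fun=> fun=> 0).
  by apply/funext => t; apply/funext => phi; apply/funext => v; rewrite /closed_loop add0r.
apply: robust => xi t.
by rewrite enormE /sqn dotv0l sqrtr0 mulr_ge0 ?enorm_ge0 ?ltW.
Qed.
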